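(* It is undecidable, given an automatic relation $R\subseteq\Sigma^*\times\Gamma^*$ and a regular control language $L\subseteq\{1,2\}^*$, whether there exists an $L$-controlled subsequential transducer that uniformizes $R$.
   Context: $\Sigma,\Gamma$ are disjoint finite alphabets. For $w\in(\Sigma\cup\Gamma)^*$, $\llbracket w\rrbracket=(\pi_{\mathtt i}(w),\pi_{\mathtt o}(w))$ where $\pi_{\mathtt i}$ (resp. $\pi_{\mathtt o}$) deletes all letters of $\Gamma$ (resp. $\Sigma$). A relation is automatic if it equals $\{\llbracket w\rrbracket:w\in S\}$ for some regular $S\subseteq(\Sigma\Gamma)^*(\Sigma^*+\Gamma^* )$. A subsequential transducer $\mathcal T$ has finite state set $Q$, initial state $q_0$, partial transition function $Q\times\Sigma\to\Gamma^*\times Q$, final states $F$, final output function $f:F\to\Gamma^*$; a run $q_0\xrightarrow{a_1|v_1}p_1\cdots\xrightarrow{a_n|v_n}p_n$, $p_n\in F$, maps $a_1\cdots a_n$ to $v_1\cdots v_nf(p_n)$ and contributes $a_1v_1\cdots a_nv_nf(p_n)$ to its synchronization language $S(\mathcal T)$. Let $h$ be the morphism $(\Sigma\cup\Gamma)^*\to\{1,2\}^*$ mapping each letter of $\Sigma$ to $1$ and each letter of $\Gamma$ to $2$. $\mathcal T$ is $L$-controlled if $h(S(\mathcal T))\subseteq L$. $\mathcal T$ uniformizes $R$ if the function it computes is defined exactly on $\mathrm{dom}(R)$ and maps each $u$ to some $v$ with $(u,v)\in R$. *)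

(* Defs.v *)
From mathcomp Require Import all_boot.
Set Implicit Arguments. Unset Strict Implicit. Unset Printing Implicit Defensive.

Inductive recf : Type :=
| rZero
| rSucc
| rProj (i : nat)
| rComp (f : recf) (gs : seq recf)
| rPrim (f g : recf)
| rMu (f : recf).

Inductive eval : recf -> seq nat -> nat -> Prop :=
| evZero v : eval rZero v 0
| evSucc x v : eval rSucc (x :: v) x.+1
| evProj i v : i < size v -> eval (rProj i) v (nth 0 v i)
| evComp f gs v ys y : evals gs v ys -> eval f ys y -> eval (rComp f gs) v y
| evPrim0 f g v y : eval f v y -> eval (rPrim f g) (0 :: v) y
| evPrimS f g n v y z :
    eval (rPrim f g) (n :: v) y -> eval g (n :: y :: v) z ->
    eval (rPrim f g) (n.+1 :: v) z
| evMu f v n : eval f (n :: v) 0 ->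
    (forall m, m < n -> exists y, 0 < y /\ eval f (m :: v) y) ->
    eval (rMu f) v n
with evals : seq recf -> seq nat -> seq nat -> Prop :=
| evsNil v : evals [::] v [::]
| evsCons g gs v y ys : eval g v y -> evals gs v ys -> evals (g :: gs) v (y :: ys).

Definition rec_decidable (X : countType) (P : X -> Prop) : Prop :=
  exists f : recf, forall x : X,
    (P x -> eval f [:: pickle x] 1) /\ (~ P x -> eval f [:: pickle x] 0).

(* Finite automata (DFA) over letters coded as naturals.                     *)
(* A DFA is (tbl, fins): states are naturals, initial state 0,               *)
(* delta q c = nth 0 (nth [::] tbl q) c, final states = fins.  Only finitely *)
(* many states are reachable, and every DFA is representable this way.       *)
Definition dfa := (seq (seq nat) * seq nat)%type.
Definition dfa_delta (A : dfa) (q c : nat) : nat := nth 0 (nth [::] A.1 q) c.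
Definition dfa_accepts (A : dfa) (w : seq nat) : bool :=
  foldl (dfa_delta A) 0 w \in A.2.

Definition pi_i (S G : Type) (w : seq (S + G)) : seq S :=
  pmap (fun x => if x is inl a then Some a else None) w.
Definition pi_o (S G : Type) (w : seq (S + G)) : seq G :=
  pmap (fun x => if x is inr b then Some b else None) w.

Definition is_inl (S G : Type) (x : S + G) : bool := if x is inl _ then true else false.
Definition is_inr (S G : Type) (x : S + G) : bool := if x is inr _ then true else false.

Fixpoint sync_shape (S G : Type) (w : seq (S + G)) : bool :=
  match w with
  | inl _ :: inr _ :: w' => sync_shape w'
  | _ => all (@is_inl S G) w || all (@is_inr S G) w
  end.

Definition code (m k : nat) (x : 'I_m + 'I_k) : nat :=
  match x with inl i => val i | inr j => m + val j end.

Definition autrel (m k : nat) (A : dfa) (u : seq 'I_m) (v : seq 'I_k) : Prop :=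
  exists w : seq ('I_m + 'I_k),
    [/\ sync_shape w, dfa_accepts A (map (@code m k) w), pi_i w = u & pi_o w = v].

(* fo q = Some f  iff  q is final with final output f.                       *)
Record sst (S G : Type) := SST {
  st : finType;
  q0 : st;
  dl : st -> S -> option (seq G * st);
  fo : st -> option (seq G) }.

Fixpoint trun (S G : Type) (T : sst S G) (q : st T) (u : seq S)
  : option (seq (S + G) * st T) :=
  match u with
  | [::] => Some ([::], q)
  | a :: u' =>
    match @dl _ _ T q a with
    | None => None
    | Some (v, p) =>
      match @trun _ _ T p u' with
      | None => None
      | Some (w, r) => Some (inl a :: map inr v ++ w, r)
      end
    end
  end.

Definition sync (S G : Type) (T : sst S G) (u : seq S) : option (seq (S + G)) :=
  match @trun _ _ T (@q0 _ _ T) u with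
  | None => None
  | Some (w, p) => omap (fun f => w ++ map inr f) (@fo _ _ T p)
  end.

Definition out (S G : Type) (T : sst S G) (u : seq S) : option (seq G) :=
  omap (@pi_o S G) (sync T u).

Definition inS (S G : Type) (T : sst S G) (w : seq (S + G)) : Prop :=
  exists u, sync T u = Some w.

Definition hmorph (S G : Type) (w : seq (S + G)) : seq nat :=
  map (fun x => if x is inl _ then 1 else 2) w.

Definition ctrl_lang (C : dfa) (w : seq nat) : bool :=
  all (fun c => (c == 1) || (c == 2)) w && dfa_accepts C w.

Definition controlled (S G : Type) (C : dfa) (T : sst S G) : Prop :=
  forall w, inS T w -> ctrl_lang C (hmorph w).

Definition uniformizes (S G : Type) (T : sst S G) (R : seq S -> seq G -> Prop) : Prop :=
  (forall u, (exists v, R u v) <-> sync T u <> None) /\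
  (forall u v, out T u = Some v -> R u v).

(* Instances: (|Sigma|, |Gamma|, DFA for the automatic relation, DFA for L). *)
Definition instance := (nat * nat * dfa * dfa)%type.

Definition unif_problem (x : instance) : Prop :=
  let: (m, k, A, C) := x in
  exists T : sst 'I_m 'I_k, controlled C T /\ uniformizes T (@autrel m k A).

(* Main.v *)
(* The control language [1 2^N (12)^*] lets the transducer choose, at the first
   input letter, how many letters its output is ahead of its input; the letters
   already produced but not yet aligned with the input form a queue of constant
   length.  An input letter is a tick or a challenge.  To a challenge the
   transducer has to react by a mark; reading the aligned pairs, the automaton
   of the relation then knows which letter a fixed queue automaton writes at
   this point, and compares it with the letter before the mark.  That letter was
   produced earlier, so the transducer must simulate the queue automaton on
   every run of ticks.  The queue automaton simulates a counter machine, uses up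
   a blank in every pass, and loses when none is left, so that the transducer
   succeeds, for a large enough queue, exactly when the machine halts.

   Given a decision procedure, the machine computes the answer for the instance
   attached to itself and halts exactly when the answer is negative.  It has
   access to its own instance because the coding of lists is affine in the tail:
   all that depends on the program in the code of the instance are four numbers,
   and the initial contents of the queue, hence of the registers, is prescribed
   by rows that can be appended to the table of the automaton. *)

Require Import Defs.
From mathcomp Require Import all_boot zify.

Set Implicit Arguments.
Unset Strict Implicit.
Unset Printing Implicit Defensive.

(** * Counter machines *)

Definition store := nat -> nat.
Definition upd (s : store) (r x : nat) : store :=
  fun q => if q == r then x else s q.

Lemma updE (s : store) r x : upd s r x r = x.
Proof. by rewrite /upd eqxx. Qed.

Lemma upd_neq (s : store) r x q : q != r -> upd s r x q = s q.
Proof. by rewrite /upd => /negbTE ->. Qed.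

(* [(a, r, t, t')]: increment [a]; if [r] was positive, decrement it and go to
   [t], otherwise go to [t'].  Without a register [r] the jump is to [t'].  A
   single instruction form keeps the later simulation by a queue uniform. *)
Definition ins := (option nat * option nat * nat * nat)%type.

Definition inc_opt (a : option nat) (s : store) : store :=
  if a is Some r then upd s r (s r).+1 else s.

Definition istep (i : ins) (s : store) : nat * store :=
  let: (a, r, t, t') := i in
  match r with
  | Some q => if 0 < s q then (t, inc_opt a (upd s q (s q).-1))
              else (t', inc_opt a s)
  | None => (t', inc_opt a s)
  end.

Definition ins0 : ins := (None, None, 0, 0).

Definition mstep (P : seq ins) (c : nat * store) : nat * store :=
  if c.1 < size P then istep (nth ins0 P c.1) c.2 else c.

Definition halts (P : seq ins) (s : store) : Prop :=
  exists t, size P <= (iter t (mstep P) (0, s)).1.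

Lemma mstep_cat P1 i P2 s p : size P1 = p ->
  mstep (P1 ++ i :: P2) (p, s) = istep i s.
Proof.
by move=> <-; rewrite /mstep /= size_cat /= nth_cat ltnn subnn addnS ltnS leq_addr.
Qed.

Lemma iter_halted P c t t' : size P <= (iter t (mstep P) c).1 -> t <= t' ->
  size P <= (iter t' (mstep P) c).1.
Proof.
move=> H /subnK <-; elim: (t' - t) => [|n IH]; first by rewrite add0n.
by rewrite addSn iterS /mstep ltnNge IH.
Qed.

Inductive cmd : Type :=
| CSkip
| CInc (r : nat)
| CSeq (c d : cmd)
| CWhile (r : nat) (c : cmd).

Inductive exec : cmd -> store -> store -> Prop :=
| ExSkip s : exec CSkip s s
| ExInc r s : exec (CInc r) s (upd s r (s r).+1)
| ExSeq c d s1 s2 s3 : exec c s1 s2 -> exec d s2 s3 -> exec (CSeq c d) s1 s3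
| ExWhile0 r c s : s r = 0 -> exec (CWhile r c) s s
| ExWhileS r c s1 s2 s3 : 0 < s1 r ->
    exec c (upd s1 r (s1 r).-1) s2 -> exec (CWhile r c) s2 s3 ->
    exec (CWhile r c) s1 s3.

(** Jumps are absolute, hence the start address [p]; control leaves the code at the address right
    behind it. *)
Fixpoint code_cmd (c : cmd) (p : nat) : seq ins :=
  match c with
  | CSkip => [::]
  | CInc r => [:: (Some r, None, 0, p.+1)]
  | CSeq c d => code_cmd c p ++ code_cmd d (p + size (code_cmd c p))
  | CWhile r c =>
    let l := code_cmd c p.+1 in
    (None, Some r, p.+1, p + size l + 2) :: rcons l (None, None, 0, p)
  end.

(** The code runs inside an arbitrary program because the induction meets each piece between others.
    After a round, a loop is back at its own address, where the second induction hypothesis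
    applies. *)
Lemma exec_code c s s' : exec c s s' ->
  forall P1 P2 p, size P1 = p ->
  exists t, iter t (mstep (P1 ++ code_cmd c p ++ P2)) (p, s)
            = (p + size (code_cmd c p), s').
Proof.
elim=> {c s s'}.
- by move=> s P1 P2 p _; exists 0; rewrite /= addn0.
- by move=> r s P1 P2 p Hp; exists 1; rewrite /= (mstep_cat _ _ _ Hp) addn1.
- move=> c d s1 s2 s3 _ IH1 _ IH2 P1 P2 p Hp.
  have [t1] := IH1 P1 (code_cmd d (p + size (code_cmd c p)) ++ P2) p Hp.
  have [|t2] := IH2 (P1 ++ code_cmd c p) P2 (p + size (code_cmd c p)).
    by rewrite size_cat Hp.
  rewrite -!catA /= size_cat addnA => E2 E1; exists (t2 + t1).
  by rewrite iterD E1 E2.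
- move=> r c s s0 P1 P2 p Hp; exists 1.
  by rewrite /= (mstep_cat _ _ _ Hp) /= s0 /= size_rcons; congr (_, _); lia.
- move=> r c s1 s2 s3 s1r _ IH1 _ IH2 P1 P2 p Hp /=.
  set l := code_cmd c p.+1; set i := (None, Some r, _, _).
  set P := P1 ++ _.
  have EP : P = rcons P1 i ++ l ++ ((None, None, 0, p) :: P2).
    by rewrite /P -cats1 -!catA /= cat_rcons.
  have [t1 E1] : exists t, iter t (mstep P) (p.+1, upd s1 r (s1 r).-1)
                           = (p.+1 + size l, s2).
    by rewrite EP; apply: IH1; rewrite size_rcons Hp.
  have [t2 E2] := IH2 P1 P2 p Hp.
  exists (t2 + (1 + (t1 + 1))); rewrite iterD iterD iterD.
  rewrite [iter 1 _ _ in X in iter t1 _ X]/=.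
  rewrite {3}/P (mstep_cat _ _ _ Hp) /= s1r E1.
  have -> : mstep P (p.+1 + size l, s2) = (p, s2).
    rewrite EP catA mstep_cat //.
    by rewrite size_cat size_rcons Hp.
  by rewrite E2.
Qed.

(** * Compiling recursive functions *)

Definition cclear (r : nat) : cmd := CWhile r CSkip.

(** Reading a register empties it, so the contents of [x] goes to [t] and from there back to [x] and
    into [o] at once. *)
Definition ccopy (x o t : nat) : cmd :=
  CSeq (CSeq (cclear o) (cclear t))
       (CSeq (CWhile x (CInc t)) (CWhile t (CSeq (CInc x) (CInc o)))).

Lemma exec_clear r s : exists s',
  [/\ exec (cclear r) s s', s' r = 0 & forall q, q != r -> s' q = s q].
Proof.
elim: {s}(s r) {-2}s (erefl (s r)) => [|n IH] s sr.
  by exists s; split=> //; apply: ExWhile0.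
have [|s' [Hs' s'r Hq]] := IH (upd s r n); first by rewrite updE.
exists s'; split=> //.
  by apply: ExWhileS Hs'; rewrite sr //; apply: ExSkip.
by move=> q qr; rewrite Hq // upd_neq.
Qed.

Lemma exec_move x t s : x != t -> exists s',
  [/\ exec (CWhile x (CInc t)) s s', s' x = 0, s' t = s t + s x
    & forall q, q != x -> q != t -> s' q = s q].
Proof.
move=> xt.
elim: {s}(s x) {-2}s (erefl (s x)) => [|n IH] s sx.
  by exists s; split=> //; [apply: ExWhile0 | rewrite sx addn0].
pose s1 := upd s x n; pose s2 := upd s1 t (s1 t).+1.
have s1t : s1 t = s t by rewrite /s1 upd_neq // eq_sym.
have [|s' [Hs' s'x s't Hq]] := IH s2.
  by rewrite /s2 upd_neq // /s1 updE.
exists s'; split=> //.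
- by apply: ExWhileS Hs'; rewrite sx //; apply: ExInc.
- by rewrite s't /s2 updE s1t upd_neq // /s1 updE addSnnS -sx.
- by move=> q qx qt; rewrite Hq // /s2 upd_neq // /s1 upd_neq.
Qed.

Lemma exec_move2 t x o s : t != x -> t != o -> x != o -> exists s',
  [/\ exec (CWhile t (CSeq (CInc x) (CInc o))) s s',
      s' x = s x + s t, s' o = s o + s t
    & forall q, q != t -> q != x -> q != o -> s' q = s q].
Proof.
move=> tx to xo.
elim: {s}(s t) {-2}s (erefl (s t)) => [|n IH] s st.
  by exists s; split; rewrite ?st ?addn0 //; apply: ExWhile0.
pose s1 := upd s t n; pose s2 := upd s1 x (s1 x).+1.
pose s3 := upd s2 o (s2 o).+1.
have s3t : s3 t = n by rewrite /s3 upd_neq // /s2 upd_neq // /s1 updE.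
have s3x : s3 x = (s x).+1.
  by rewrite /s3 upd_neq // /s2 updE /s1 upd_neq // eq_sym.
have s3o : s3 o = (s o).+1.
  by rewrite /s3 updE /s2 upd_neq 1?eq_sym // /s1 upd_neq // eq_sym.
have [|s' [Hs' s'x s'o Hq]] := IH s3; first by [].
exists s'; split=> //.
- apply: ExWhileS Hs'; rewrite st //.
  by apply: ExSeq; apply: ExInc.
- by rewrite s'x s3x s3t st; lia.
- by rewrite s'o s3o s3t st; lia.
- by move=> q qt qx qo; rewrite Hq // /s3 upd_neq // /s2 upd_neq // /s1 upd_neq.
Qed.

Lemma exec_copy x o t s : x != o -> x != t -> o != t -> exists s',
  [/\ exec (ccopy x o t) s s', s' o = s x
    & forall q, q != o -> q != t -> s' q = s q].
Proof.
move=> xo xt ot.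
have [s1 [E1 s1o H1]] := exec_clear o s.
have [s2 [E2 s2t H2]] := exec_clear t s1.
have [s3 [E3 s3x s3t H3]] := exec_move s2 xt.
have tx : t != x by rewrite eq_sym.
have to : t != o by rewrite eq_sym.
have [s4 [E4 s4x s4o H4]] := exec_move2 s3 tx to xo.
have s2x : s2 x = s x by rewrite H2 // H1.
exists s4; split.
- by apply: ExSeq (ExSeq E1 E2) (ExSeq E3 E4).
- by rewrite s4o s3t s2t s2x H3 // 1?eq_sym // H2 // s1o.
- move=> q qo qt; have [->|qx] := eqVneq q x.
    by rewrite s4x s3x s3t s2t s2x.
  by rewrite H4 // H3 // H2 // H1.
Qed.

(* Arguments are read from the registers [args], the result is stored in [o],
   and every register from [b] on is scratch space. *)
Fixpoint comp (e : recf) (args : seq nat) (o b : nat) {struct e} : cmd :=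
  match e with
  | rZero => cclear o
  | rSucc => CSeq (ccopy (head 0 args) o b) (CInc o)
  | rProj i => ccopy (nth 0 args i) o b
  | rComp f gs =>
    let b' := b + size gs in
    CSeq ((fix comps (gs : seq recf) (j : nat) : cmd :=
             if gs is g :: gs' then CSeq (comp g args j b') (comps gs' j.+1)
             else CSkip) gs b)
         (comp f (iota b (size gs)) o b')
  | rPrim f g =>
    let ps := behead args in
    CSeq (CSeq (ccopy (head 0 args) b.+2 b.+3) (cclear b))
         (CSeq (comp f ps b.+1 b.+4)
               (CSeq (CWhile b.+2
                        (CSeq (comp g (b :: b.+1 :: ps) b.+3 b.+4)
                              (CSeq (ccopy b.+3 b.+1 b.+4) (CInc b))))
                     (ccopy b.+1 o b.+3)))
  | rMu f =>
    CSeq (cclear b)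
         (CSeq (comp f (b :: args) b.+1 b.+2)
               (CSeq (CWhile b.+1
                        (CSeq (CInc b) (comp f (b :: args) b.+1 b.+2)))
                     (ccopy b o b.+1)))
  end.

Definition comps (args : seq nat) (b' : nat) :=
  fix comps (gs : seq recf) (j : nat) : cmd :=
    if gs is g :: gs' then CSeq (comp g args j b') (comps gs' j.+1)
    else CSkip.

(** The generated principle gives no hypothesis for the members of the list in [rComp]; an inner
    recursion over the list supplies one. *)
Fixpoint recf_ind_seq (P : recf -> Prop)
  (hZ : P rZero) (hS : P rSucc) (hp : forall i, P (rProj i))
  (hC : forall f gs, P f -> (forall i, i < size gs -> P (nth rZero gs i)) ->
        P (rComp f gs))
  (hR : forall f g, P f -> P g -> P (rPrim f g))
  (hM : forall f, P f -> P (rMu f)) (e : recf) {struct e} : P e :=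
  let rec := recf_ind_seq hZ hS hp hC hR hM in
  match e return P e with
  | rZero => hZ
  | rSucc => hS
  | rProj i => hp i
  | rComp f gs => hC f gs (rec f)
      ((fix all_nth (gs : seq recf) : forall i, i < size gs -> P (nth rZero gs i) :=
          match gs return forall i, i < size gs -> P (nth rZero gs i) with
          | [::] => fun i lt_i => False_ind _ (Bool.diff_false_true lt_i)
          | g :: gs' => fun i =>
              match i return i < size (g :: gs') -> P (nth rZero (g :: gs') i) with
              | 0 => fun _ => rec g
              | i'.+1 => fun lt_i => all_nth gs' i' lt_i
              end
          end) gs)
  | rPrim f g => hR f g (rec f) (rec g)
  | rMu f => hM f (rec f)
  end.

Definition comp_correct (e : recf) : Prop :=
  forall v y, eval e v y -> forall args o b s,
  map s args = v -> all (fun r => r < b) args -> o < b -> o \notin args ->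
  exists s', [/\ exec (comp e args o b) s s', s' o = y
               & forall q, q < b -> q != o -> s' q = s q].

Lemma map_frame (s s' : store) (b : nat) args :
  all (fun r => r < b) args -> (forall q, q < b -> s' q = s q) ->
  map s' args = map s args.
Proof. by move=> /allP H E; apply/eq_in_map => q /H /E. Qed.

Lemma ltn_neq q r : q < r -> q != r.
Proof. by rewrite ltn_neqAle => /andP[]. Qed.

Lemma notin_ge (b o : nat) args : all (fun r => r < b) args -> b <= o ->
  o \notin args.
Proof.
move=> /allP H bo; apply: contraTN bo => /H; by rewrite -ltnNge.
Qed.

Lemma comp_zero : comp_correct rZero.
Proof.
move=> v y; move E: rZero => e He; case: He E => // {e}v' _ args o b s _ _ ob _.
have [s' [E1 E2 E3]] := exec_clear o s; exists s'; split=> //.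
by move=> q _ /E3.
Qed.

Lemma comp_succ : comp_correct rSucc.
Proof.
move=> v y; move E: rSucc => e He; case: He E => // {e}x v' _.
case=> [//|a args] o b s [sa _] /andP[ab _] ob; rewrite inE negb_or => /andP[oa _].
have [s' [E1 E2 E3]] : exists s', [/\ exec (ccopy a o b) s s', s' o = s a
    & forall q, q != o -> q != b -> s' q = s q].
  by apply: exec_copy; [rewrite eq_sym | exact: ltn_neq | exact: ltn_neq].
exists (upd s' o (s' o).+1); split.
- by apply: (ExSeq E1); apply: ExInc.
- by rewrite updE E2 sa.
- by move=> q qb qo; rewrite upd_neq // E3 // ltn_neq.
Qed.

Lemma comp_proj i : comp_correct (rProj i).
Proof.
move=> v y; move E: (rProj i) => e He; case: He E => // {e}j v' lt_j [ij].
rewrite -{}ij in lt_j * => {j} args o b s Hv /allP Hargs ob oa.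
subst v'; rewrite size_map in lt_j.
have ai : nth 0 args i \in args by rewrite mem_nth.
have [s' [E1 E2 E3]] : exists s', [/\ exec (ccopy (nth 0 args i) o b) s s',
    s' o = s (nth 0 args i) & forall q, q != o -> q != b -> s' q = s q].
  apply: exec_copy; [|exact/ltn_neq/Hargs|exact: ltn_neq].
  by apply: contra oa => /eqP <-.
exists s'; split=> //; first by rewrite E2 (nth_map 0).
by move=> q qb qo; rewrite E3 // ltn_neq.
Qed.

(** The arguments and the results found so far lie below the current target [j], and scratch space
    begins at [b'], behind the last target; so nothing needed later is overwritten. *)
Lemma comps_correct args (b b' : nat) gs :
  (forall i, i < size gs -> comp_correct (nth rZero gs i)) ->
  forall v ys, evals gs v ys -> forall j s, b <= j -> j + size gs = b' ->
  map s args = v -> all (fun r => r < b) args ->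
  exists s', [/\ exec (comps args b' gs j) s s',
                 map s' (iota j (size gs)) = ys
               & forall q, q < j -> s' q = s q].
Proof.
elim: gs => [|g gs IH] Hgs v ys.
  move E: [::] => gs He; case: He E => // {gs ys}v0 _ j s _ _ _ _.
  by exists s; split=> //; apply: ExSkip.
move E: (g :: gs) => gs0 He; case: He E Hgs => // {ys}g0 gs1 v0 y ys Hg Hgs'.
move=> [? ?] Hgs j s bj jb Hv Ha; subst g0 gs1.
have Haj : all (fun r => r < j) args.
  by apply: sub_all Ha => r /leq_trans; apply.
have Hab : all (fun r => r < b') args.
  by apply: sub_all Haj => r; rewrite -jb /=; lia.
have jb' : j < b' by rewrite -jb /=; lia.
have [s1 [E1 s1j H1]] := Hgs 0 (ltn0Sn _) _ _ Hg args j b' s Hv Hab jb'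
  (notin_ge Haj (leqnn _)).
have H1' q : q < j -> s1 q = s q.
  by move=> qj; apply: H1; rewrite ?(ltn_trans qj) // ltn_neq.
have [i lt_i||||//|s2 [E2 s2j H2]] := IH _ _ _ Hgs' j.+1 s1.
- exact: (Hgs i.+1).
- exact: leqW.
- by rewrite -jb /=; lia.
- by rewrite (map_frame Haj H1').
exists s2; split.
- by apply: ExSeq E1 E2.
- by rewrite /= s2j H2 ?leqnn // s1j.
- by move=> q qj; rewrite H2 ?H1' // (ltn_trans qj).
Qed.

Lemma comp_comp f gs : comp_correct f ->
  (forall i, i < size gs -> comp_correct (nth rZero gs i)) ->
  comp_correct (rComp f gs).
Proof.
move=> Hf Hgs v y; move E: (rComp f gs) => e He.
case: He E => // {e y}f0 gs0 v0 ys y Egs Ef [ef egs].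
move: Egs Ef; rewrite -ef -egs => Egs Ef {f0 ef gs0 egs}.
move=> args o b s Hv Ha ob oa.
have [s1 [E1 s1y H1]] := comps_correct Hgs Egs (leqnn b) (erefl _) Hv Ha.
have [|||s2 [E2 s2o H2]] := Hf _ _ Ef (iota b (size gs)) o (b + size gs) s1 s1y.
- by apply/allP => q; rewrite mem_iota => /andP[].
- by rewrite (leq_trans ob) // leq_addr.
- by rewrite mem_iota leqNgt ob.
exists s2; split=> //; first by apply: ExSeq E1 E2.
by move=> q qb qo; rewrite H2 ?H1 // (leq_trans qb) // leq_addr.
Qed.

(** Layout: [b] counts the rounds done, [b.+1] holds the value reached, [b.+2] the number of rounds
    left, [b.+3] the new value. *)
Lemma comp_prim f g : comp_correct f -> comp_correct g ->
  comp_correct (rPrim f g).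
Proof.
move=> Hf Hg v0 z Hev args o b s Hv Ha ob oa.
have [n [v Ev]] : exists n v, v0 = n :: v.
  move E: (rPrim f g) Hev => e He.
  by case: He E => // [f' g' v1 y _ _|f' g' n v1 y z' _ _ _];
     [exists 0, v1 | exists n.+1, v1].
case: args Hv Ha oa => [|a ps]; first by rewrite Ev.
rewrite Ev => -[sa Hv] /= /andP[ab Ha]; rewrite inE negb_or => /andP[oa oa'].
subst v0.
have Ha4 : all (fun r => r < b.+4) ps by apply: sub_all Ha => r /=; lia.
set body := CSeq (comp g (b :: b.+1 :: ps) b.+3 b.+4) _.

(* The rounds already run are recorded by what remains to be executed, so that
   the induction can follow [eval] from the inside out. *)
have loop n' : forall z', eval (rPrim f g) (n' :: v) z' -> forall c s0,
    map s0 ps = v -> s0 b = 0 -> s0 b.+2 = n' + c ->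
    exists s1 s2, [/\ exec (comp f ps b.+1 b.+4) s0 s1,
      (forall s3, exec (CWhile b.+2 body) s2 s3 -> exec (CWhile b.+2 body) s1 s3),
      [/\ s2 b = n', s2 b.+1 = z' & s2 b.+2 = c]
      & forall q, q < b -> s2 q = s0 q].
  elim: n' => [|m IH] z' Hz c s0 Hs0 s0b s0c.
    have Ef : eval f v z'.
      move E: (rPrim f g) Hz => e; move E': (0 :: v) => v1 He.
      by case: He E E' => // f' g' v' y H' [? _] [?]; subst.
    have [||s1 [E1 s1z H1]] := Hf _ _ Ef ps b.+1 b.+4 s0 Hs0 Ha4.
    - lia.
    - by apply: (notin_ge Ha); lia.
    exists s1, s1; split=> //.
      by split=> //; rewrite H1 //; lia.
    by move=> q qb; rewrite H1 //; lia.
  have [y Hy Hgy] : exists2 y, eval (rPrim f g) (m :: v) y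
                            & eval g (m :: y :: v) z'.
    move E: (rPrim f g) Hz => e; move E': (m.+1 :: v) => v1 He.
    by case: He E E' => // f' g' k v' y z1 H1 H2 [? ?] [? ?]; subst; exists y.
  have [|s1 [s2 [E1 Hloop [s2b s2y s2c] H2]]] := IH y Hy c.+1 s0 Hs0 s0b.
    by rewrite s0c addSnnS.
  pose t0 := upd s2 b.+2 c.
  have [||||t1 [F1 t1z Ht1]] := Hg _ _ Hgy (b :: b.+1 :: ps) b.+3 b.+4 t0.
  - rewrite /= /t0 !upd_neq ?s2b ?s2y; try lia; congr [:: _, _ & _].
    by rewrite -Hs0; apply: (map_frame Ha) => q qb; rewrite upd_neq ?H2 //; lia.
  - by rewrite /= Ha4; lia.
  - lia.
  - by rewrite !inE !negb_or (notin_ge Ha) ?andbT; lia.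
  have [|||t2 [F2 t2z Ht2]] := @exec_copy b.+3 b.+1 b.+4 t1; try lia.
  exists s1, (upd t2 b (t2 b).+1); split=> //.
  - move=> s3 Hs3; apply: Hloop.
    apply: (ExWhileS (s2 := upd t2 b (t2 b).+1)) Hs3; rewrite s2c //=.
    by apply: ExSeq F1 (ExSeq F2 _); apply: ExInc.
  - split.
    + by rewrite updE Ht2 ?Ht1 /t0 ?upd_neq ?s2b //; lia.
    + by rewrite upd_neq ?t2z ?t1z //; lia.
    + by rewrite upd_neq ?Ht2 ?Ht1 /t0 ?updE //; lia.
  - by move=> q qb; rewrite upd_neq ?Ht2 ?Ht1 /t0 ?upd_neq ?H2 //; lia.
have [|||s1 [E1 s1n H1]] := @exec_copy a b.+2 b.+3 s; try lia.
have [s2 [E2 s2b H2]] := exec_clear b s1.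
have [|||s3 [s4 [E3 Hloop [s4b s4z s4c] H4]]] := loop n z Hev 0 s2.
- by rewrite -Hv; apply: (map_frame Ha) => q qb; rewrite H2 ?H1 //; lia.
- by [].
- by rewrite H2 ?s1n ?sa ?addn0 //; lia.
have [|||s5 [E5 s5o H5]] := @exec_copy b.+1 o b.+3 s4; try lia.
exists s5; split.
- apply: ExSeq (ExSeq E1 E2) (ExSeq E3 (ExSeq _ E5)).
  by apply: Hloop; apply: ExWhile0.
- by rewrite s5o.
- by move=> q qb qo; rewrite H5 ?H4 ?H2 ?H1 //; lia.
Qed.

(** Register [b] holds the candidate and [b.+1] the value of [f] there; the loop runs while this
    value is positive. *)
Lemma comp_mu f : comp_correct f -> comp_correct (rMu f).
Proof.
move=> Hf v n; move E: (rMu f) => e He.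
case: He E => // {e}f' v' n' H0 Hpos [ef] args o b s Hv Ha ob oa.
subst f' v'.
have Ha2 : all (fun r => r < b.+2) (b :: args).
  by rewrite /= ltnW //=; apply: sub_all Ha => r /=; lia.
have Hb1 : b.+1 \notin b :: args.
  by rewrite inE negb_or (notin_ge Ha) // andbT; lia.
rewrite /=; set body := CSeq (CInc b) _.
have [s1 [E1 s1b H1]] := exec_clear b s.
have loop m y : m <= n' -> eval f (m :: map s args) y -> exists s2 s3,
  [/\ exec (comp f (b :: args) b.+1 b.+2) s1 s2,
      (forall s4, exec (CWhile b.+1 body) s3 s4 -> exec (CWhile b.+1 body) s2 s4),
      s3 b = m, s3 b.+1 = y & forall q, q < b -> s3 q = s q].
  elim: m y => [|m IH] y lm Hy.
    have [||s2 [E2 s2y H2]] := Hf _ _ Hy (b :: args) b.+1 b.+2 s1 _ Ha2 _ Hb1.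
    - by rewrite /= s1b; congr (_ :: _); apply: (map_frame Ha) => q qb;
        rewrite H1 //; lia.
    - by [].
    exists s2, s2; split=> //; first by rewrite H2 //; lia.
    by move=> q qb; rewrite H2 ?H1 //; lia.
  have [x [x0 Hx]] := Hpos m lm.
  have [s2 [s3 [E2 Hloop s3b s3x H3]]] := IH x (ltnW lm) Hx.
  pose t0 := upd s3 b.+1 x.-1.
  pose t1 := upd t0 b (t0 b).+1.
  have t1b : t1 b = m.+1 by rewrite /t1 updE /t0 upd_neq ?s3b //; lia.
  have [||t2 [F2 t2y Ht2]] := Hf _ _ Hy (b :: args) b.+1 b.+2 t1 _ Ha2 _ Hb1.
  - rewrite /= t1b; congr (_ :: _); apply: (map_frame Ha) => q qb.
    by rewrite /t1 upd_neq ?/t0 ?upd_neq ?H3 //; lia.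
  - by [].
  exists s2, t2; split=> //.
  - move=> s4 Hs4; apply: Hloop.
    apply: (ExWhileS (s2 := t2)) Hs4; rewrite s3x //.
    by apply: ExSeq F2; apply: ExInc.
  - by rewrite Ht2 ?t1b //; lia.
  - by move=> q qb; rewrite Ht2 ?/t1 ?upd_neq ?/t0 ?upd_neq ?H3 //; lia.
have [s2 [s3 [E2 Hloop s3b s3y H3]]] := loop n' 0 (leqnn _) H0.
have [|||s5 [E5 s5o H5]] := @exec_copy b o b.+1 s3; try lia.
exists s5; split.
- apply: ExSeq E1 (ExSeq E2 (ExSeq _ E5)).
  by apply: Hloop; apply: ExWhile0.
- by rewrite s5o.
- by move=> q qb qo; rewrite H5 ?H3 //; lia.
Qed.

Lemma compP e : comp_correct e.
Proof.
elim/recf_ind_seq: e => [|| i | f gs Hf Hgs | f g Hf Hg | f Hf].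
- exact: comp_zero.
- exact: comp_succ.
- exact: comp_proj.
- exact: comp_comp.
- exact: comp_prim.
- exact: comp_mu.
Qed.

(** The last two instructions leave the program if the result is 0 and otherwise enter a jump to
    itself. *)
Definition prog_of (e : recf) (n : nat) : seq ins :=
  let l := code_cmd (comp e (iota 0 n) n n.+1) 0 in
  l ++ [:: (None, Some n, (size l).+1, (size l).+2);
           (None, None, 0, (size l).+1)].

Lemma prog_of_run e v y : eval e v y ->
  exists t s, iter t (mstep (prog_of e (size v))) (0, nth 0 v)
    = (size (prog_of e (size v)) - 2, s) /\ s (size v) = y.
Proof.
move=> He; set n := size v.
have [||||s [E sn _]] := compP He (args := iota 0 n) (o := n) (b := n.+1)
  (s := nth 0 v).
- by rewrite /n map_nth_iota0 // take_size.
- by apply/allP => q; rewrite mem_iota add0n => /andP[_ /ltnW].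
- by [].
- by rewrite mem_iota ltnn andbF.
have [t Et] := exec_code E (P1 := [::])
  [:: (None, Some n, (size (code_cmd (comp e (iota 0 n) n n.+1) 0)).+1,
      (size (code_cmd (comp e (iota 0 n) n n.+1) 0)).+2);
      (None, None, 0, (size (code_cmd (comp e (iota 0 n) n n.+1) 0)).+1)]
  (erefl 0).
by exists t, s; rewrite /prog_of size_cat addnK.
Qed.

Lemma prog_of_halts e v : eval e v 0 -> halts (prog_of e (size v)) (nth 0 v).
Proof.
move=> /prog_of_run[t [s [E s0]]]; exists t.+1.
rewrite iterS E; rewrite /prog_of size_cat addnK mstep_cat //= s0 /=.
by rewrite addn2.
Qed.

Lemma prog_of_diverges e v y : eval e v y.+1 ->
  ~ halts (prog_of e (size v)) (nth 0 v).
Proof.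
move=> /prog_of_run[t [s [E sy]]] [t0 Ht0].
set P := prog_of _ _ in E Ht0.
have Psz : 2 <= size P by rewrite /P /prog_of size_cat leq_addl.
have loop k : exists s', iter (k + t.+1) (mstep P) (0, nth 0 v)
                         = (size P - 1, s').
  elim: k => [|k [s' IH]].
    rewrite add0n iterS E /P /prog_of size_cat addnK mstep_cat //= sy /=.
    by rewrite addnS subn1 addn1; eexists.
  rewrite addSn iterS IH; exists s'.
  have -> : size P - 1 = (size P - 2).+1 by lia.
  rewrite /P /prog_of size_cat addnK /= -cat1s catA mstep_cat //.
  by rewrite size_cat addn1.
have [s' Es'] := loop t0.
have := iter_halted Ht0 (leq_addr t.+1 t0).
by rewrite Es' /=; lia.
Qed.
(** * Computability of the reduction *)

Definition computable (n : nat) (h : seq nat -> nat) : Prop :=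
  exists r, forall v, size v = n -> eval r v (h v).

Lemma computable_ext n h h' : computable n h ->
  (forall v, size v = n -> h v = h' v) -> computable n h'.
Proof. by move=> [r Hr] E; exists r => v Hv; rewrite -E //; apply: Hr. Qed.

Lemma computable_proj n i : i < n -> computable n (fun v => nth 0 v i).
Proof. by move=> lt_i; exists (rProj i) => v Hv; apply: evProj; rewrite Hv. Qed.

Lemma computable_succ n h : computable n h -> computable n (fun v => (h v).+1).
Proof.
move=> [r Hr]; exists (rComp rSucc [:: r]) => v Hv.
apply: (evComp (ys := [:: h v])); last exact: evSucc.
by apply: evsCons; [apply: Hr | apply: evsNil].
Qed.

Lemma computable_const n c : computable n (fun=> c).
Proof.
elim: c => [|c IH]; first by exists rZero => v _; apply: evZero.
exact: computable_succ IH.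
Qed.

Lemma evals_projs s v : all (fun i => i < size v) s ->
  evals [seq rProj i | i <- s] v [seq nth 0 v i | i <- s].
Proof.
elim: s => [|i s IH] /=; first by move=> _; apply: evsNil.
by move=> /andP[Hi Hs]; apply: evsCons; [apply: evProj | apply: IH].
Qed.

Lemma computable_drop n h m : computable n h ->
  computable (m + n) (fun v => h (drop m v)).
Proof.
move=> [r Hr]; exists (rComp r [seq rProj i | i <- iota m n]) => v Hv.
apply: (evComp (ys := drop m v)); last first.
  by apply: Hr; rewrite size_drop Hv addKn.
have -> : drop m v = [seq nth 0 v i | i <- iota m n].
  by rewrite map_nth_iota ?Hv ?addKn // take_oversize // size_drop Hv addKn.
by apply: evals_projs; apply/allP => i; rewrite mem_iota Hv => /andP[].
Qed.

Lemma eval_iteri r rf F G v n : eval rf v F ->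
  (forall i y, eval r (i :: y :: v) (G i y)) ->
  eval (rPrim rf r) (n :: v) (iteri n G F).
Proof.
move=> HF HG; elim: n => [|n IH]; first exact: evPrim0.
by apply: evPrimS IH _; apply: HG.
Qed.

Lemma computable_iteri n B F G : computable n B -> computable n F ->
  computable n.+2 G ->
  computable n (fun v => iteri (B v) (fun i y => G [:: i, y & v]) (F v)).
Proof.
move=> [rB HB] [rF HF] [rG HG].
exists (rComp (rPrim rF rG) (rB :: [seq rProj i | i <- iota 0 n])) => v Hv.
apply: (evComp (ys := B v :: v)); last first.
  apply: eval_iteri; first exact: HF.
  by move=> i y; apply: HG; rewrite /= Hv.
apply: evsCons; first exact: HB.
have {2}-> : v = [seq nth 0 v i | i <- iota 0 n].
  by rewrite map_nth_iota0 ?Hv // -Hv take_size.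
by apply: evals_projs; apply/allP => i; rewrite mem_iota Hv.
Qed.

Lemma computable_add n h k : computable n h -> computable n k ->
  computable n (fun v => h v + k v).
Proof.
move=> Hh Hk; have := computable_iteri Hk Hh
  (computable_succ (@computable_proj n.+2 1 isT)).
move/computable_ext; apply => v _ /=.
by elim: (k v) => [|x /= ->]; rewrite ?addn0 ?addnS.
Qed.

Lemma computable_mul n h k : computable n h -> computable n k ->
  computable n (fun v => h v * k v).
Proof.
move=> Hh Hk; have := computable_iteri Hk (computable_const n 0)
  (computable_add (@computable_proj n.+2 1 isT) (computable_drop 2 Hh)).
move/computable_ext; apply => v _ /=; rewrite drop0.
by elim: (k v) => [|x /= ->]; rewrite ?muln0 // mulnS addnC.
Qed.

Lemma computable_exp2 n h : computable n h -> computable n (fun v => 2 ^ h v).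
Proof.
move=> Hh; have := computable_iteri Hh (computable_const n 1)
  (computable_add (@computable_proj n.+2 1 isT) (@computable_proj n.+2 1 isT)).
move/computable_ext; apply => v _ /=.
by elim: (h v) => [|x /= ->]; rewrite ?expn0 // expnS mul2n addnn.
Qed.

Lemma computable_pred n h : computable n h -> computable n (fun v => (h v).-1).
Proof.
move=> Hh; have := computable_iteri Hh (computable_const n 0)
  (@computable_proj n.+2 0 isT).
by move/computable_ext; apply => v _ /=; case: (h v).
Qed.

Lemma computable_sub n h k : computable n h -> computable n k ->
  computable n (fun v => h v - k v).
Proof.
move=> Hh Hk; have := computable_iteri Hk Hh
  (computable_pred (@computable_proj n.+2 1 isT)).
move/computable_ext; apply => v _ /=.
by elim: (k v) => [|x /= ->]; rewrite ?subn0 ?subnS.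
Qed.

(** * Arithmetic of list codes *)

Definition ccons (x t : nat) : nat := 2 ^ x * t.*2.+1.

Lemma code_cons x s : CodeSeq.code (x :: s) = ccons x (CodeSeq.code s).
Proof. by []. Qed.

Lemma computable_ccons n h k : computable n h -> computable n k ->
  computable n (fun v => ccons (h v) (k v)).
Proof.
move=> Hh Hk; apply: computable_mul; first exact: computable_exp2.
apply: computable_succ; have := computable_add Hk Hk.
by move/computable_ext; apply => v _; rewrite addnn.
Qed.

(* Since coding is affine in the tail, a fixed initial part of a table enters the
   code of the whole table only through the two numbers of [params]. *)
Lemma code_cat s t : CodeSeq.code (s ++ t) =
  CodeSeq.code s + 2 ^ sumn (map S s) * CodeSeq.code t.
Proof.
elim: s => [|x s IH]; first by rewrite /= expn0 mul1n.
rewrite cat_cons !code_cons IH /ccons /= addSn expnS expnD -!mul2n.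
by rewrite mulnDr -addSn mulnDr; congr (_ + _); rewrite mulnCA !mulnA.
Qed.

Lemma pickle_seq_nat (l : seq nat) : pickle l = CodeSeq.code l.
Proof. by rewrite [LHS]/(CodeSeq.code (map id l)) map_id. Qed.

(* Rows of an automaton that reads a word of letters [W] from state [q] on, then
   a block of letters 1, and accepts (state 1) at the letter 0.  Columns 0 and 1
   stand for the two input letters. *)
Fixpoint chain (W : seq nat) (q : nat) : seq (seq nat) :=
  if W is x :: W' then [:: 1, 1 & ncons x 0 [:: q.+1]] :: chain W' q.+1
  else [:: [:: 1; 1; 1; q]].

Definition chain_code (W : seq nat) (q : nat) : nat :=
  CodeSeq.code (map CodeSeq.code (chain W q)).

Definition row_code (x q : nat) : nat :=
  ccons 1 (ccons 1 (iteri x (fun _ y => ccons 0 y) (ccons q 0))).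

Lemma row_codeE x q :
  CodeSeq.code [:: 1, 1 & ncons x 0 [:: q]] = row_code x q.
Proof.
rewrite !code_cons /row_code; congr (ccons _ (ccons _ _)).
by elim: x => //= x <-.
Qed.

(** Code of the chain rows for [c] equal letters [x], in front of a table with code [t]. Rows are
    added from the last one, which leads to state [e], so a long run of letters is a mere
    iteration. *)
Definition segment (x c e t : nat) : nat :=
  iteri c (fun i y => ccons (row_code x (e - i)) y) t.

Lemma chain_segment x c W q :
  chain_code (nseq c x ++ W) q = segment x c (q + c) (chain_code W (q + c)).
Proof.
elim: c q => [|c IH] q; first by rewrite addn0.
rewrite /chain_code [nseq _ _ ++ _]/= [chain _ _]/= map_cons code_cons row_codeE.
rewrite -/(chain_code _ _) IH /segment /= addSnnS addnS -addSn addnK.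
by rewrite addSn.
Qed.

Lemma computable_row n x h : computable n h ->
  computable n (fun v => row_code x (h v)).
Proof.
move=> Hh; apply: computable_ccons (computable_const _ _) _.
apply: computable_ccons (computable_const _ _) _.
apply: (@computable_iteri n (fun=> x) _ (fun v => ccons 0 (nth 0 v 1))).
- exact: computable_const.
- by apply: computable_ccons Hh (computable_const _ _).
- exact: computable_ccons (computable_const _ _) (computable_proj _).
Qed.

Lemma computable_segment n x c e t : computable n c -> computable n e ->
  computable n t -> computable n (fun v => segment x (c v) (e v) (t v)).
Proof.
move=> Hc He Ht.
have := computable_iteri Hc Ht (computable_ccons
  (computable_row x (computable_sub (computable_drop 2 He)
     (@computable_proj n.+2 0 isT)))
  (@computable_proj n.+2 1 isT)).
by move/computable_ext; apply => v _ /=; rewrite drop0.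
Qed.

(* Letter [4 + r] is a token of register [r]. *)
Definition tokens (a b n k : nat) : seq nat :=
  nseq a 4 ++ nseq b 5 ++ nseq n 6 ++ nseq k 7.

(** For a control automaton with code [C], four numbers determine the code of the instance: the code
    [a] and the factor [b] of the fixed rows, their number [n], and the number [k] of output
    letters. The chain spells these same numbers in unary. *)
Definition inst_code (C : nat) (v : seq nat) : nat :=
  let a := nth 0 v 0 in let b := nth 0 v 1 in
  let n := nth 0 v 2 in let k := nth 0 v 3 in
  let e0 := n + 2 in let e1 := e0 + a in let e2 := e1 + b in
  let e3 := e2 + n in let e4 := e3 + k in
  let last := ccons (ccons 1 (ccons 1 (ccons 1 (ccons e4 0)))) 0 in
  let chn := segment 1 2 e0 (segment 4 a e1 (segment 5 b e2 (segment 6 n e3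
               (segment 7 k e4 last)))) in
  ccons (ccons (ccons 2 (ccons k 0))
           (ccons (ccons (a + b * chn) (ccons (ccons 1 0) 0)) 0))
        (ccons C 0).

Lemma computable_inst_code C : computable 4 (inst_code C).
Proof.
have Ha := @computable_proj 4 0 isT; have Hb := @computable_proj 4 1 isT.
have Hn := @computable_proj 4 2 isT; have Hk := @computable_proj 4 3 isT.
have H0 := computable_add Hn (computable_const 4 2).
have H1 := computable_add H0 Ha; have H2 := computable_add H1 Hb.
have H3 := computable_add H2 Hn; have H4 := computable_add H3 Hk.
have Hc c := computable_const 4 c.
rewrite /inst_code; cbv zeta.
repeat first [exact: Ha | exact: Hb | exact: Hn | exact: Hk | exact: H0
  | exact: H1 | exact: H2 | exact: H3 | exact: H4 | exact: Hc
  | apply: computable_segment | apply: computable_ccons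
  | apply: computable_add | apply: computable_mul].
Qed.

Definition game_dfa (R : seq (seq nat)) (W : seq nat) : dfa :=
  (R ++ chain W (size R), [:: 1]).

Definition params (R : seq (seq nat)) (k : nat) : seq nat :=
  let l := map CodeSeq.code R in
  [:: CodeSeq.code l; 2 ^ sumn (map S l); size R; k].

(** The fixed rows enter only through [v], and the chain is written from [v]; so [v] determines the
    code of an instance in which [v] itself is spelled out. *)
Lemma pickle_inst R k (C : dfa) :
  let v := params R k in
  let W := [:: 1, 1 & tokens (nth 0 v 0) (nth 0 v 1) (nth 0 v 2) (nth 0 v 3)] in
  pickle ((2, k, game_dfa R W, C) : instance) = inst_code (pickle C) v.
Proof.
move=> v W; set l := map CodeSeq.code R.
have EA : pickle (R ++ chain W (size R)) =
    CodeSeq.code l + 2 ^ sumn (map S l) * chain_code W (size R).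
  rewrite -code_cat -map_cat; congr CodeSeq.code.
  by apply/eq_map => s; rewrite pickle_seq_nat.
have -> : pickle ((2, k, game_dfa R W, C) : instance) =
    CodeSeq.code [:: CodeSeq.code [:: CodeSeq.code [:: 2; k];
      CodeSeq.code [:: pickle (R ++ chain W (size R)); pickle [:: 1]] ]; pickle C].
  by [].
rewrite EA !code_cons; congr (ccons (ccons _ (ccons (ccons (_ + _ * _) _) _)) _).
have -> : W = nseq 2 1 ++ nseq (CodeSeq.code l) 4 ++
    nseq (2 ^ sumn (map S l)) 5 ++ nseq (size R) 6 ++ nseq k 7 ++ [::].
  by rewrite cats0.
by rewrite !chain_segment.
Qed.
(** * Queue automata *)

Inductive outcome (S : Type) : Type := Win | Lose | Go (s : S).
Arguments Win {S}.
Arguments Lose {S}.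

Lemma drop_rconsS (T : Type) t (w r : seq T) x y : drop t w = x :: r ->
  drop t.+1 (rcons w y) = rcons r y.
Proof.
move=> E; have lt_t : t < size w by rewrite -subn_gt0 -size_drop E.
by rewrite -addn1 addnC -drop_drop drop_rcons 1?ltnW // E /= drop0.
Qed.

Section QueueRun.

Variables (S L : Type) (step : S -> L -> outcome S) (lam : S -> L -> L).
Variables (blank : L) (s0 : S) (w0 : seq L).

(* The second component is the queue together with everything already read
   from it; at time [t] the head of the queue is its entry number [t]. *)
Fixpoint qrun (t : nat) : outcome S * seq L :=
  match t with
  | 0 => (Go s0, w0)
  | t'.+1 =>
    let: (o, w) := qrun t' in
    match o with
    | Go s => (step s (nth blank w t'), rcons w (lam s (nth blank w t')))
    | _ => (o, rcons w blank)
    end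
  end.

Fixpoint pass (s : S) (w : seq L) : option (S * seq L) :=
  match w with
  | [::] => Some (s, [::])
  | x :: w' =>
    if step s x is Go s1 then
      if pass s1 w' is Some (s2, v) then Some (s2, lam s x :: v) else None
    else None
  end.

Lemma size_qrun t : size (qrun t).2 = size w0 + t.
Proof.
elim: t => [|t IH]; first by rewrite addn0.
by rewrite /= addnS -IH; case: (qrun t) => [[||s] w] /=; rewrite size_rcons.
Qed.

Lemma qrun_Win t t' : t <= t' -> (qrun t).1 = Win -> (qrun t').1 = Win.
Proof.
move/subnK=> <-; elim: (t' - t) => // n IH /IH.
by rewrite addSn /=; case: (qrun _) => [o w] /= ->.
Qed.

Lemma qrun_Lose t t' : t <= t' -> (qrun t).1 = Lose -> (qrun t').1 = Lose.
Proof.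
move/subnK=> <-; elim: (t' - t) => // n IH /IH.
by rewrite addSn /=; case: (qrun _) => [o w] /= ->.
Qed.

Lemma qrun_pass t s w v r s' v' : qrun t = (Go s, w) -> drop t w = v ++ r ->
  pass s v = Some (s', v') ->
  exists w', qrun (t + size v) = (Go s', w') /\ drop (t + size v) w' = r ++ v'.
Proof.
elim: v t s w r v' => [|x v IH] t s w r v' Ht Hw /=.
  by case=> <- <-; exists w; rewrite addn0 cats0.
case Ex: (step s x) => [||s1] //; case Ep: (pass s1 v) => [[s2 v2]|//].
case=> E1 E2; rewrite E1 in Ep.
have xw : nth blank w t = x by rewrite -[t]addn0 -nth_drop Hw.
have lt_t : t < size w by rewrite -subn_gt0 -size_drop Hw.
have [||w' [H1 H2]] := IH t.+1 s1 (rcons w (lam s x)) (rcons r (lam s x)) v2 _ _ Ep.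
- by rewrite /= Ht xw Ex.
- by rewrite (drop_rconsS _ Hw) rcons_cat.
by exists w'; rewrite addnS -addSn H1 H2 cat_rcons E2.
Qed.

Definition qletter (t : nat) : L := nth blank (qrun t).2 t.

Lemma qrun_step t s : (qrun t).1 = Go s -> (qrun t.+1).1 = step s (qletter t).
Proof. by rewrite /qletter /=; case: (qrun t) => [o w] /= ->. Qed.

Lemma qrun_Go_prev t t' s : t' <= t -> (qrun t).1 = Go s ->
  exists s', (qrun t').1 = Go s'.
Proof.
move=> /subnK <-; elim: (t - t') s => [|d IH] s; first by exists s.
rewrite addSn /= => H; move: IH H; case: (qrun _) => [[||s'] w] //= IH _.
exact: IH.
Qed.

Lemma qrun_nth t t' i : t <= t' -> i < size w0 + t ->
  nth blank (qrun t').2 i = nth blank (qrun t).2 i.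
Proof.
move=> /subnK <- lt_i; elim: (t' - t) => // d IH.
have lt_i' : i < size (qrun (d + t)).2.
  by rewrite size_qrun (leq_trans lt_i) // leq_add2l leq_addl.
rewrite addSn /= -{}IH; move: lt_i'; case: (qrun _) => [[||s] w] /= lt_i';
  by rewrite nth_rcons lt_i'.
Qed.

Lemma qletter_init i : i < size w0 -> qletter i = nth blank w0 i.
Proof. by move=> lt_i; rewrite /qletter (@qrun_nth 0) ?addn0. Qed.

(** The queue keeps its length, so what is written at time [j] is read [size w0] steps later. This
    is the condition that challenges test. *)
Lemma qletter_lam j s : 0 < size w0 -> (qrun j).1 = Go s ->
  qletter (size w0 + j) = lam s (qletter j).
Proof.
move=> w0_gt0 Hj.
have E : nth blank (qrun j.+1).2 (size w0 + j) = lam s (qletter j).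
  rewrite /qletter /=; move: (size_qrun j) Hj.
  by case: (qrun j) => [o w] /= <- ->; rewrite nth_rcons ltnn eqxx.
rewrite -E /qletter (@qrun_nth j.+1) //; first by rewrite -add1n leq_add2r.
by rewrite addnS.
Qed.

Lemma qletterP (p : pred L) : p blank -> all p w0 ->
  (forall s x, p x -> p (lam s x)) -> forall t, p (qletter t).
Proof.
move=> pb pw plam t; rewrite /qletter.
suff /(all_nthP blank) H : all p (qrun t).2.
  have [lt_t|le_t] := ltnP t (size (qrun t).2); first exact: H.
  by rewrite nth_default.
elim: t => //= t; case: (qrun t) => [o w] /= Hw.
case: o => [||s] /=; rewrite all_rcons Hw ?pb //= andbT plam //.
have [lt_t|le_t] := ltnP t (size w); last by rewrite nth_default.
by move/(all_nthP blank): Hw; apply.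
Qed.

End QueueRun.

(** * Counter machines as queue automata *)

Section MachineQueue.

Variables (K : nat) (P : seq ins).

(** Letter 0 is kept free for the mark. The lock keeps simplification from unfolding [inord]. *)
Definition lt (n : nat) : 'I_K.+4 := locked (inord n).
Definition blank := lt 1.
Definition burnt := lt 3.
Definition sep := lt 2.
Definition tok (r : nat) := lt r.+4.
Definition is_tok (r : option nat) (x : 'I_K.+4) : bool :=
  if r is Some q then x == tok q else false.

Definition ins_bounded (i : ins) : bool :=
  let: (a, r, _, _) := i in
  (if a is Some q then q < K else true) && (if r is Some q then q < K else true).

Hypothesis P_bounded : all ins_bounded P.

(* The contents of register [r] is the number of tokens [tok r] in the queue.
   One pass over the queue, up to its separator, executes one instruction; the
   flags tell whether a blank, resp. a token of the register to be
   decremented, has been met.  Each pass uses up one blank. *)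
Definition qstate := option ('I_(size P) * bool * bool).

Definition goto (t : nat) : outcome qstate :=
  if insub t is Some i then Go (Some (i, false, false)) else Win.

Definition qstep (s : qstate) (x : 'I_K.+4) : outcome qstate :=
  if s is Some (i, u, d) then
    let: (_, r, t, t') := nth ins0 P i in
    if x == sep then if u then goto (if d then t else t') else Lose
    else if x == blank then Go (Some (i, true, d))
    else Go (Some (i, u, d || is_tok r x))
  else goto 0.

(** To keep the length, the first blank of a pass becomes the incremented token, or a burnt letter,
    and the first token to be decremented becomes burnt. New letters are read only in the next pass,
    so an increment does not influence the test in the same instruction. *)
Definition qlam (s : qstate) (x : 'I_K.+4) : 'I_K.+4 :=
  if s is Some (i, u, d) then
    let: (a, r, _, _) := nth ins0 P i in
    if (x == blank) && ~~ u then (if a is Some q then tok q else burnt)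
    else if ~~ d && is_tok r x then burnt
    else x
  else sep.

Lemma lt_eq m n : m < K.+4 -> n < K.+4 -> (lt m == lt n) = (m == n).
Proof. by move=> Hm Hn; rewrite /lt -!lock -val_eqE /= !inordK. Qed.

Lemma tok_eq m n : m < K -> n < K -> (tok m == tok n) = (m == n).
Proof. by move=> Hm Hn; rewrite lt_eq. Qed.

(** Raising [u] costs a blank and creates a token of [a], if any; raising [d] costs a token of [r].
    The balances are stated for arbitrary initial flags, as the induction requires, and without
    subtraction. *)
Lemma pass_spec (i : 'I_(size P)) a r t t' :
  nth ins0 P i = (a, r, t, t') -> forall w u d, sep \notin w ->
  exists (u' d' : bool) w', [/\ pass qstep qlam (Some (i, u, d)) w
                       = Some (Some (i, u', d'), w'),
    sep \notin w' /\ u' = u || (blank \in w), d' = d || has (is_tok r) w,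
    count_mem blank w' + u' = count_mem blank w + u
    & forall q, q < K ->
      count_mem (tok q) w' + (r == Some q) * d' + (a == Some q) * u =
      count_mem (tok q) w + (r == Some q) * d + (a == Some q) * u'].
Proof.
move=> Ei; have /all_nthP := P_bounded.
move=> /(_ ins0 i (ltn_ord i)); rewrite Ei /= => /andP[Ha Hr].
elim=> [|x w IH] u d; first by exists u, d, [::]; split; rewrite ?orbF.
rewrite inE negb_or => /andP[xs ws].
have bs : blank == sep = false by rewrite lt_eq.
have us : burnt == sep = false by rewrite lt_eq.
have ub : burnt == blank = false by rewrite lt_eq.
have ut q : q < K -> burnt == tok q = false by move=> ?; rewrite lt_eq.
have bt q : q < K -> blank == tok q = false by move=> ?; rewrite lt_eq.
have tb q : q < K -> tok q == blank = false by move=> ?; rewrite lt_eq.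
have ts q : q < K -> tok q == sep = false by move=> ?; rewrite lt_eq.
have rb : is_tok r blank = false by case: (r) Hr => //= q /bt.
rewrite eq_sym in xs; rewrite /= Ei (negbTE xs).
have [->|xb] := eqVneq x blank.
  have [u' [d' [w' [-> [w's u'E] -> H1 H2]]]] := IH true d ws.
  rewrite andTb rb andbF.
  exists u', (d || has (is_tok r) w).
  exists ((if ~~ u then if a is Some q then tok q else burnt else blank) :: w').
  rewrite u'E in H1 H2 *; split=> //.
  - rewrite inE negb_or w's andbT inE eqxx orbT; split=> //.
    rewrite eq_sym; case: u => /=; rewrite ?bs //.
    by case: a Ha {Ei H2 IH} => [q|] Hq; rewrite ?ts ?us.
  - move: H1; rewrite /=; case: u => /=; first by rewrite eqxx; clear; lia.
    by case: a Ha {Ei H2 IH} => [q|] Hq; rewrite ?tb ?ub //; clear; lia.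
  - move=> q qK /=; have := H2 q qK; rewrite bt // add0n.
    case: u => /=; rewrite ?bt //= ?muln0 ?addn0 ?muln1.
    case: a Ha {Ei H2 IH} => [q'|] Hq.
      by rewrite tok_eq // (inj_eq Some_inj); clear; lia.
    by rewrite ut //=; clear; lia.
have [u' [d' [w' [-> [w's u'E] d'E H1 H2]]]] := IH u (d || is_tok r x) ws.
rewrite andFb; exists u', d'.
exists ((if ~~ d && is_tok r x then burnt else x) :: w'); split=> //.
- rewrite inE negb_or w's andbT inE eq_sym (eq_sym blank) (negbTE xb) u'E.
  by split=> //; case: ifP; rewrite ?us.
- by rewrite d'E orbA.
- by rewrite /= add0n -H1; case: ifP => _; rewrite ?ub ?(negbTE xb).
- move=> q qK /=; have := H2 q qK.
  case: r Hr {Ei H1 H2 rb IH d'E} => [q'|] Hr /=; last first.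
    by rewrite andbF orbF; clear; lia.
  have [->|xq] := eqVneq x (tok q').
    rewrite tok_eq // (inj_eq Some_inj) andbT.
    by case: d => /=; rewrite ?tok_eq ?ut //; clear; lia.
  by rewrite andbF orbF; clear; lia.
Qed.

(** [F] counts the blanks left, that is, the instructions that can still be executed. A halted
    machine is matched too, with outcome [Win]. *)
Definition matches (pc : nat) (s : store) (F : nat) (t : nat) w0 : Prop :=
  exists w v, [/\ qrun qstep qlam blank None w0 t = (goto pc, w),
    drop t w = rcons v sep, sep \notin v, count_mem blank v = F
    & forall q, q < K -> count_mem (tok q) v = s q].

Lemma matches_step pc s F t w0 : pc < size P -> matches pc s F.+1 t w0 ->
  exists t', matches (mstep P (pc, s)).1 (mstep P (pc, s)).2 F t' w0.
Proof.
move=> lt_pc [w [v [Ht Hw vs vF vs']]].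
rewrite /goto insubT in Ht; set i := Sub pc lt_pc in Ht.
case Ei: (nth ins0 P i) => [[[a r] t1] t2].
have [u' [d' [v' [E [v's u'E] d'E H1 H2]]]] := pass_spec Ei false false vs.
rewrite -cats1 in Hw.
have [w' [Ht' Hw']] := qrun_pass Ht Hw E.
have bv : blank \in v by rewrite -has_pred1 has_count vF.
rewrite bv /= in u'E; rewrite u'E in Ht' H1 H2.
(* One pass over [v], then one more step that reads the separator, writes it back and jumps. *)
exists (t + size v).+1; rewrite /matches /= Ht' /= Ei /mstep lt_pc /=.
have hd : nth blank w' (t + size v) = sep.
  by rewrite -[t + size v]addn0 -nth_drop Hw'.
have lt_w' : t + size v < size w' by rewrite -subn_gt0 -size_drop Hw'.
rewrite hd eqxx -[nth ins0 P pc]/(nth ins0 P i) Ei /=.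
have sb : sep == blank = false by rewrite lt_eq.
have st : is_tok r sep = false.
  have /all_nthP := P_bounded; move=> /(_ ins0 i (ltn_ord i)); rewrite Ei /=.
  by case: (r) => // q /andP[_ qK] /=; rewrite lt_eq.
rewrite sb st !andbF.
have hr : d' = if r is Some q then 0 < s q else false.
  rewrite d'E /=; have /all_nthP := P_bounded.
  move=> /(_ ins0 i (ltn_ord i)); rewrite Ei /=; case: (r) => [q|].
    by move=> /andP[_ qK]; rewrite -vs' // -has_count; apply: eq_has.
  by move=> _; rewrite (eq_has (a2 := pred0)) ?has_pred0.
exists (rcons w' sep), v'; split=> //.
- by rewrite hr; case: (r) => [q|] //=; case: (0 < s q).
- exact: drop_rconsS Hw'.
- by move: H1; rewrite vF /=; clear; lia.
- move=> q qK; have := H2 q qK.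
  rewrite vs' // [nat_of_bool false]/= [nat_of_bool true]/= !muln0 !addn0 muln1 hr.
  have inc (s1 : store) : inc_opt a s1 q = s1 q + (a == Some q).
    case: (a) => [q'|] /=; last by rewrite addn0.
    rewrite (inj_eq Some_inj) /upd [q == _]eq_sym.
    by case: eqP => [->|_]; rewrite ?addn1 ?addn0.
  case: (r) => [q'|] /=; last by rewrite inc ?mul0n ?addn0.
  case: ifP => sq' /=; rewrite inc; last by rewrite ?muln0 ?addn0.
  rewrite (inj_eq Some_inj) /upd [q == _]eq_sym; case: eqP => [q'q|_] /=.
    by rewrite q'q in sq' *; move: sq'; clear; lia.
  by rewrite mul0n addn0.
Qed.

Lemma matches_stuck pc s t w0 : pc < size P -> matches pc s 0 t w0 ->
  exists t', (qrun qstep qlam blank None w0 t').1 = Lose.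
Proof.
move=> lt_pc [w [v [Ht Hw vs vF vs']]].
rewrite /goto insubT in Ht; set i := Sub pc lt_pc in Ht.
case Ei: (nth ins0 P i) => [[[a r] t1] t2].
have [u' [d' [v' [E [v's u'E] d'E H1 H2]]]] := pass_spec Ei false false vs.
rewrite -cats1 in Hw.
have [w' [Ht' Hw']] := qrun_pass Ht Hw E.
have bv : (blank \in v) = false by rewrite -has_pred1 has_count vF.
rewrite bv /= in u'E; rewrite u'E in Ht'.
have hd : nth blank w' (t + size v) = sep.
  by rewrite -[t + size v]addn0 -nth_drop Hw'.
by exists (t + size v).+1; rewrite /= Ht' /= Ei hd eqxx.
Qed.

(** The separator belongs behind a padding of unknown length and cannot be prescribed: the initial
    state reads the leading letter 1 and writes the separator instead, at the end of the queue. *)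
Definition initial_queue (v : seq nat) (p : nat) : seq 'I_K.+4 :=
  map lt (1 :: tokens (nth 0 v 0) (nth 0 v 1) (nth 0 v 2) (nth 0 v 3))
  ++ nseq p blank.

Lemma matches_init v p : 3 < K -> size v = 4 ->
  matches 0 (nth 0 v) p 1 (initial_queue v p).
Proof.
move=> K3; case: v => [//|a [//|b [//|c [//|d [|//]]]]] _.
rewrite /matches /= /initial_queue.
eexists; eexists; split; first by [].
- by rewrite /= drop0.
- rewrite mem_cat negb_or; apply/andP; split; last first.
    by rewrite mem_nseq lt_eq // andbF.
  rewrite /tokens !map_cat !map_nseq !mem_cat !mem_nseq !lt_eq ?andbF //; lia.
- rewrite /tokens !map_cat !map_nseq !count_cat !count_nseq /= !lt_eq //=; lia.
- move=> q qK.
  rewrite /tokens !map_cat !map_nseq !count_cat !count_nseq /= !lt_eq //=; try lia.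
  by move: q qK => [|[|[|[|q]]]] qK; rewrite /= ?nth_nil; lia.
Qed.

(** Each instruction uses up one of the [p] blanks and a pass without blanks loses, so never losing
    bounds the running time by [p]. *)
Lemma queue_never_loses_halts v p : 3 < K -> size v = 4 ->
  (forall t, (qrun qstep qlam blank None (initial_queue v p) t).1 <> Lose) ->
  halts P (nth 0 v).
Proof.
move=> K3 Hv NL; set w0 := initial_queue v p in NL.
suff H pc s t : matches pc s p t w0 ->
    exists n, size P <= (iter n (mstep P) (pc, s)).1.
  exact: H (matches_init p K3 Hv).
clearbody w0; elim: p pc s t => [|F IH] pc s t Hm;
  have [le_pc|lt_pc] := leqP (size P) pc; try by exists 0.
  by have [t' /NL] := matches_stuck lt_pc Hm.
have [t' Hm'] := matches_step lt_pc Hm.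
have [n Hn] := IH _ _ _ Hm'.
by exists n.+1; rewrite iterSr; case: (mstep _ _) Hn.
Qed.

Lemma halts_queue_wins v : 3 < K -> size v = 4 -> halts P (nth 0 v) ->
  exists p t, (qrun qstep qlam blank None (initial_queue v p) t).1 = Win.
Proof.
move=> K3 Hv [n Hn]; exists n; set w0 := initial_queue v n.
suff H pc s t : matches pc s n t w0 ->
    size P <= (iter n (mstep P) (pc, s)).1 ->
    exists t', (qrun qstep qlam blank None w0 t').1 = Win.
  exact: H (matches_init n K3 Hv) Hn.
have win pc' s' F t' : size P <= pc' -> matches pc' s' F t' w0 ->
    exists t', (qrun qstep qlam blank None w0 t').1 = Win.
  move=> le_pc [w [v' [Ht _ _ _ _]]]; exists t'.
  by rewrite Ht /goto insubF //= ltnNge le_pc.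
clearbody w0; elim: n pc s t {Hn} => [|n IH] pc s t Hm Hn.
  exact: win Hn Hm.
have [le_pc|lt_pc] := leqP (size P) pc; first exact: win le_pc Hm.
have [t' Hm'] := matches_step lt_pc Hm.
apply: (IH _ _ _ Hm').
by move: Hn; rewrite iterSr; case: (mstep _ _).
Qed.

Lemma qlam_nonmark s x : x != lt 0 -> qlam s x != lt 0.
Proof.
move=> x0; case: s => [[[i u] d]|] /=; last by rewrite lt_eq.
case Ei: (nth ins0 P i) => [[[a r] t1] t2].
have /all_nthP := P_bounded; move=> /(_ ins0 i (ltn_ord i)); rewrite Ei /=.
move=> /andP[Ha _]; case: ifP => _; last by case: ifP => _ //; rewrite lt_eq.
by case: a Ha {Ei} => [q|] Hq; rewrite lt_eq.
Qed.

(** A loss happens only at a separator. An output of blanks is therefore safe, which puts enough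
    inputs into the domain of the relation. *)
Lemma qstep_blank s : qstep s blank <> Lose.
Proof.
case: s => [[[i u] d]|] /=; last by rewrite /goto; case: insub.
by case: (nth ins0 P i) => [[[a r] t1] t2]; rewrite lt_eq // eqxx.
Qed.

End MachineQueue.
(** * The specification automaton *)

Fixpoint mix (S G : Type) (u : seq S) (v : seq G) : seq (S + G) :=
  match u, v with
  | a :: u', b :: v' => inl a :: inr b :: mix u' v'
  | _, [::] => map inl u
  | [::], _ => map inr v
  end.

Lemma pi_i_inl (S G : Type) (u : seq S) : pi_i (map (@inl S G) u) = u.
Proof. by elim: u => //= a u ->. Qed.

Lemma pi_i_inr (S G : Type) (v : seq G) : pi_i (map (@inr S G) v) = [::].
Proof. by elim: v. Qed.

Lemma pi_o_inl (S G : Type) (u : seq S) : pi_o (map (@inl S G) u) = [::].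
Proof. by elim: u. Qed.

Lemma pi_o_inr (S G : Type) (v : seq G) : pi_o (map (@inr S G) v) = v.
Proof. by elim: v => //= a v ->. Qed.

Lemma mix_nil (S G : Type) (u : seq S) : mix u ([::] : seq G) = map inl u.
Proof. by case: u. Qed.

Lemma mixP (S G : Type) (u : seq S) (v : seq G) :
  [/\ sync_shape (mix u v), pi_i (mix u v) = u & pi_o (mix u v) = v].
Proof.
elim: u v => [|a u IH] [|b v]; rewrite ?mix_nil.
- by [].
- rewrite /= pi_i_inr pi_o_inr; split=> //.
  by rewrite all_map; elim: v.
- rewrite pi_i_inl pi_o_inl; split=> //.
  by case: u {IH} => //= b u; rewrite all_map; elim: u.
- by have [H1 H2 H3] := IH v; rewrite /= H2 H3.
Qed.

Lemma sync_shape_eq (S G : Type) (w : seq (S + G)) :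
  sync_shape w -> w = mix (pi_i w) (pi_o w).
Proof.
have all_l (l : seq (S + G)) : all (@is_inl S G) l ->
    l = mix (pi_i l) (pi_o l).
  elim: l => //= -[a|//] l IH /= Hl; have Ho : pi_o l = [::].
    by elim: l Hl {IH} => //= -[].
  by rewrite {1}IH // Ho mix_nil /=.
have all_r (l : seq (S + G)) : all (@is_inr S G) l ->
    l = mix (pi_i l) (pi_o l).
  elim: l => //= -[//|b] l IH /= Hl; have Ho : pi_i l = [::].
    by elim: l Hl {IH} => //= -[].
  by rewrite {1}IH // Ho; case: (pi_o l).
elim: {w}(size w) {-2}w (leqnn (size w)) => [|n IH] w.
  by case: w.
case: w => [|[a|b] [|[c|d] w]] //= Hn.
- by rewrite orbF => H; apply: (all_l (inl a :: inl c :: w)).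
- by move=> H; rewrite {1}[w]IH // ltnW.
- by move=> H; apply: (all_r (inr b :: inr d :: w)).
Qed.

(** The shape leaves no choice in interleaving [u] and [v], so the existential reduces to
    [mix u v]. *)
Lemma autrelP (m k : nat) (A : dfa) (u : seq 'I_m) (v : seq 'I_k) :
  autrel A u v <-> dfa_accepts A (map (@code m k) (mix u v)).
Proof.
split=> [[w [Hs Ha <- <-]]|Ha]; first by rewrite -sync_shape_eq.
by have [H1 H2 H3] := mixP u v; exists (mix u v).
Qed.

Definition tick : 'I_2 := ord0.
Definition chal : 'I_2 := ord_max.

Lemma tick_or_chal (a : 'I_2) : {a = tick} + {a = chal}.
Proof.
case: a => [[|[|//]] lt_a]; [left | right]; exact: val_inj.
Qed.

(** * The control language *)

(* [1 2^N (12)^*] with [N >= 3]: the delay is chosen at the first letter and kept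
   afterwards. State 7 is dead. *)
Definition ctrl : dfa :=
  ([:: [:: 7; 1; 7]; [:: 7; 7; 2]; [:: 7; 7; 3]; [:: 7; 7; 4]; [:: 7; 5; 4];
       [:: 7; 7; 6]; [:: 7; 5; 7]; [:: 7; 7; 7]], [:: 4; 6]).

Definition cstate (q : nat) (S G : Type) (w : seq (S + G)) : nat :=
  foldl (dfa_delta ctrl) q (hmorph w).

Lemma cstate_cat q (S G : Type) (w w' : seq (S + G)) :
  cstate q (w ++ w') = cstate (cstate q w) w'.
Proof. by rewrite /cstate /hmorph map_cat foldl_cat. Qed.

Lemma cstate_dead (S G : Type) (w : seq (S + G)) : cstate 7 w = 7.
Proof. by rewrite /cstate; elim: w => //= -[a|b] w IH. Qed.

Lemma hmorph_inr (S G : Type) (v : seq G) :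
  hmorph (map (@inr S G) v) = nseq (size v) 2.
Proof. by elim: v => //= x v ->. Qed.

Lemma cstate_start (S G : Type) (a : S) (w : seq (S + G)) :
  cstate 0 (inl a :: w) = cstate 1 w.
Proof. by []. Qed.

Lemma cstate_turn q (S G : Type) (a : S) (w : seq (S + G)) :
  q \in [:: 4; 6] -> cstate q (inl a :: w) = cstate 5 w.
Proof. by rewrite !inE => /orP[] /eqP ->. Qed.

Lemma cstate_first (S G : Type) (v : seq G) :
  cstate 1 (map (@inr S G) v) = if size v < 3 then (size v).+1 else 4.
Proof.
rewrite /cstate hmorph_inr; case: (size v) => [|[|[|n]]] //.
by elim: n => //= n ->.
Qed.

Lemma cstate_later (S G : Type) (v : seq G) :
  cstate 5 (map (@inr S G) v) =
  if size v is n.+1 then if n is _.+1 then 7 else 6 else 5.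
Proof.
rewrite /cstate hmorph_inr; case: (size v) => [|[|n]] //=.
by elim: n => //= n ->.
Qed.

(** * The delay of a controlled transducer *)

Lemma trun_cat (S G : Type) (T : sst S G) (q : st T) u u' :
  trun q (u ++ u') =
  if trun q u is Some (w, p) then
    if trun p u' is Some (w', r) then Some (w ++ w', r) else None
  else None.
Proof.
elim: u q => [|a u IH] q /=; first by case: (trun q u') => [[]|].
case: (dl q a) => [[v p]|] //; rewrite IH.
case: (trun p u) => [[w r]|] //; case: (trun r u') => [[w' r']|] //.
by rewrite /= -catA.
Qed.

Lemma cstate_lt q (S G : Type) (w : seq (S + G)) : q < 8 -> cstate q w < 8.
Proof.
rewrite /cstate; elim: w q => //= x w IH q _; apply: IH.
case: x => _; rewrite /dfa_delta /=;
  by case: q => [|[|[|[|[|[|[|[|q]]]]]]]] //=; rewrite nth_nil.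
Qed.

Section Delay.

Variables (k : nat) (T : sst 'I_2 'I_k).
Hypothesis T_ctrl : controlled ctrl T.

Lemma sync_cstate u w : sync T u = Some w -> cstate 0 w \in [:: 4; 6].
Proof. by move=> E; have /andP[] := T_ctrl (ex_intro _ u E). Qed.

(** Only from these states can the control automaton read an input letter without dying, and the
    dead state is never left. *)
Lemma cstate_alive u w (a : 'I_2) w' : sync T u = Some (w ++ inl a :: w') ->
  cstate 0 w \in [:: 0; 4; 6].
Proof.
move=> /sync_cstate; rewrite cstate_cat -cat1s cstate_cat.
have := cstate_lt w (isT : 0 < 8); move: (cstate 0 w) => q.
move=> lt_q.
have /orP[/eqP ->|//] : (cstate q [:: inl a : 'I_2 + 'I_k] == 7)
    || (q \in [:: 0; 4; 6]).
  by case: q lt_q => [|[|[|[|[|[|[|[|q]]]]]]]].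
by rewrite cstate_dead.
Qed.

Hypothesis T_tick : forall n, sync T (nseq n.+1 tick) <> None.
Hypothesis T_chal : forall n, sync T (rcons (nseq n.+1 tick) chal) <> None.

Lemma trun_ticks n : exists w p, trun (q0 T) (nseq n.+1 tick) = Some (w, p).
Proof.
have := @T_tick n; rewrite /sync.
by case: (trun _ _) => [[w p]|] // _; exists w, p.
Qed.

Lemma trun_ticksS n w p : trun (q0 T) (nseq n.+1 tick) = Some (w, p) ->
  exists y p', trun (q0 T) (nseq n.+2 tick) =
    Some (w ++ inl tick :: map inr y, p').
Proof.
move=> E; have [w' [p' E']] := trun_ticks n.+1; move: E'.
have -> : nseq n.+2 tick = nseq n.+1 tick ++ [:: tick].
  by rewrite -[[:: tick]]/(nseq 1 tick) -nseqD addn1.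
rewrite trun_cat E /=; case: (dl p tick) => [[y r]|] //.
by rewrite cats0 => _; exists y, r.
Qed.

Definition block (n : nat) : seq 'I_k :=
  if trun (q0 T) (nseq n.+1 tick) is Some (w, _) then pi_o w else [::].

Lemma pi_o_cat (w w' : seq ('I_2 + 'I_k)) : pi_o (w ++ w') = pi_o w ++ pi_o w'.
Proof. exact: pmap_cat. Qed.

Lemma alive_ticks n w p : trun (q0 T) (nseq n.+1 tick) = Some (w, p) ->
  cstate 0 w \in [:: 0; 4; 6].
Proof.
move=> /trun_ticksS[y [p' E]].
case Es: (sync T (nseq n.+2 tick)) => [s|]; last by have := T_tick Es.
move: (Es); rewrite /sync E; case: (fo _) => [f|] //= [Esf].
by apply: (@cstate_alive (nseq n.+2 tick) w tick (map inr y ++ map inr f));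
  rewrite Es -Esf -catA.
Qed.

Lemma first_block : 2 < size (block 0) /\
  exists w p, trun (q0 T) [:: tick] = Some (w, p) /\ cstate 0 w = 4.
Proof.
have [w [p E]] := trun_ticks 0; have := alive_ticks E.
have [y Ew] : exists y, w = inl tick :: map inr y.
  by move: E => /=; case: (dl _ _) => [[y r]|] // [<- _]; exists y; rewrite cats0.
rewrite /block E Ew /= pi_o_inr cstate_start cstate_first.
case: ltnP => [|le3 _]; first by case: (size y) => [|[|[|]]].
split=> //; exists w, p; split; first by rewrite Ew.
by rewrite Ew cstate_start cstate_first ltnNge le3.
Qed.

Lemma next_block n w p : trun (q0 T) (nseq n.+1 tick) = Some (w, p) ->
  cstate 0 w \in [:: 4; 6] -> exists y p',
  trun (q0 T) (nseq n.+2 tick) = Some (rcons (rcons w (inl tick)) (inr y), p')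
  /\ cstate 0 (rcons (rcons w (inl tick)) (inr y)) \in [:: 4; 6].
Proof.
move=> E Hw; have [y [p' E']] := trun_ticksS E; have := alive_ticks E'.
rewrite cstate_cat cstate_turn // cstate_later.
case: y E' => [|y [|y' y'']] E' //= _; exists y, p'.
rewrite -!cats1 -!catA; split=> //.
by rewrite cstate_cat cstate_turn.
Qed.

Lemma all_blocks n : exists w p,
  trun (q0 T) (nseq n.+1 tick) = Some (w, p) /\ cstate 0 w \in [:: 4; 6].
Proof.
elim: n => [|n [w [p [E Hw]]]].
  by have [_ [w [p [E Hw]]]] := first_block; exists w, p; rewrite Hw.
by have [y [p' [E' Hw']]] := next_block E Hw;
  exists (rcons (rcons w (inl tick)) (inr y)), p'.
Qed.

Lemma blockS n : exists y, block n.+1 = rcons (block n) y.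
Proof.
have [w [p [E Hw]]] := all_blocks n.
have [y [p' [E' _]]] := next_block E Hw.
exists y; rewrite /block E E' -!cats1 -!catA pi_o_cat /=.
by rewrite cats1.
Qed.

(** The control forces [N] letters on the first tick and one on each further tick; these outputs
    extend each other and form one stream. A final challenge adds exactly one letter, on its
    transition or as final output. *)
Lemma delay_stream : exists N (v : nat -> 'I_k),
  [/\ 2 < N,
      forall n, exists g, out T (nseq n.+1 tick) = Some (mkseq v (N + n) ++ g)
    & forall n, exists x, out T (rcons (nseq n.+1 tick) chal)
                          = Some (rcons (mkseq v (N + n)) x)].
Proof.
have [lt2 _] := first_block; set N := size (block 0) in lt2.
have [x0 _] : exists x0 : 'I_k, True by case: (block 0) @N lt2 => // x; exists x.
pose v n := nth x0 (block n) n.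
have size_b n : size (block n) = N + n.
  elim: n => [|n IH]; first by rewrite addn0.
  by have [y ->] := blockS n; rewrite size_rcons IH addnS.
have nth_b n m j : n <= m -> j < N + n -> nth x0 (block m) j = nth x0 (block n) j.
  move=> /subnK <- lt_j; elim: (m - n) => // d IH.
  have [y E] := blockS (d + n); rewrite addSn E nth_rcons size_b.
  by rewrite IH (leq_trans lt_j) // leq_add2l leq_addl.
have blockE n : block n = mkseq v (N + n).
  apply: (@eq_from_nth _ x0); rewrite ?size_mkseq // size_b => j lt_j.
  rewrite nth_mkseq // /v; have [le_jn|lt_nj] := leqP j n.
    by rewrite (nth_b j n) //; lia.
  by rewrite (nth_b n j) // ltnW.
exists N, v; split=> // n.
  have [w [p [E _]]] := all_blocks n; have := @T_tick n.
  rewrite /out -blockE /block /sync E; case: (fo _) => //= f _.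
  by exists f; rewrite pi_o_cat pi_o_inr.
have [w [p [E Hw]]] := all_blocks n.
case Es: (sync T (rcons (nseq n.+1 tick) chal)) => [s|]; last by have := T_chal Es.
have Hs := sync_cstate Es.
rewrite /out Es -blockE /block E; move: Es; rewrite /sync -cats1 trun_cat E /=.
case: (dl p chal) => [[y r]|] //; case: (fo r) => [f|] //= [Es].
move: Hs; rewrite -Es cats0 -catA cat_cons -map_cat cstate_cat cstate_turn //.
rewrite cstate_later.
rewrite pi_o_cat /= pi_o_inr size_cat.
by case: y {E Es} => [|y []]; case: f => [|x []] //=; [exists x | exists y];
  rewrite cats1.
Qed.

End Delay.
(** * The game *)

Section Game.

Variables (k : nat) (mark blank : 'I_k) (S : finType).
Hypotheses (mark0 : val mark = 0) (blank1 : val blank = 1).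
Variables (step : S -> 'I_k -> outcome S) (lam : S -> 'I_k -> 'I_k) (s0 : S).

(* [F0], [F1], [F2] deal with the two first letters; [Wait s] has simulated the
   queue automaton up to state [s]; after a challenge in state [s], [Search c b]
   looks for the first mark, [b] telling whether the letter before is the
   letter [c] that the queue automaton writes. *)
Inductive gstate : Type :=
| F0 | F1 | F2
| Wait (s : S)
| Ticked (s : S)
| Asked (s : S)
| Search (c : 'I_k) (b : bool).

Inductive target : Type := Dead | Acc | ToChain | To (q : gstate).

(** In [Search] a further input letter is accepted: only a challenge at the end of the input is put
    to the test. *)
Definition on_input (q : gstate) (a : 'I_2) : target :=
  match q with
  | F1 => if a == tick then To F2 else ToChain
  | Wait s => if a == tick then To (Ticked s) else To (Asked s)
  | Search _ _ => Acc
  | _ => Dead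
  end.

(** In [F1] and [Wait] an output letter means that the input is over; nothing was challenged, and
    the automaton accepts. In [Asked] the letter aligned with the challenge tells what the queue
    automaton writes. *)
Definition on_output (q : gstate) (x : 'I_k) : target :=
  match q with
  | F0 => if x == mark then Dead else To F1
  | F2 => if x == mark then Dead else To (Wait s0)
  | Ticked s =>
    if x == mark then Dead else
    match step s x with Win => Acc | Lose => Dead | Go s' => To (Wait s') end
  | Asked s => To (Search (lam s x) false)
  | Search c b =>
    if x == mark then if b then Acc else Dead else To (Search c (x == c))
  | _ => Acc
  end.

Definition ecode : finType :=
  option (option (option (('I_k * bool) + (S * option bool)))).

Definition enc (q : gstate) : ecode :=
  match q with
  | F0 => None
  | F1 => Some None
  | F2 => Some (Some None)
  | Wait s => Some (Some (Some (inr (s, None))))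
  | Ticked s => Some (Some (Some (inr (s, Some false))))
  | Asked s => Some (Some (Some (inr (s, Some true))))
  | Search c b => Some (Some (Some (inl (c, b))))
  end.

Definition dec (e : ecode) : gstate :=
  match e with
  | None => F0
  | Some None => F1
  | Some (Some None) => F2
  | Some (Some (Some (inr (s, None)))) => Wait s
  | Some (Some (Some (inr (s, Some false)))) => Ticked s
  | Some (Some (Some (inr (s, Some true)))) => Asked s
  | Some (Some (Some (inl (c, b)))) => Search c b
  end.

Lemma encK : cancel enc dec.
Proof. by case. Qed.

(* State 0 is at the same time the initial and the dead state: it cannot be left
   by output letters.  State 1 accepts everything. *)
Definition num (q : target) : nat :=
  match q with
  | Dead => 0
  | Acc => 1
  | ToChain => #|ecode|.+2
  | To q => (enum_rank (enc q)).+2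
  end.

Arguments num : simpl never.

Definition row (q : gstate) : seq nat :=
  [seq num (on_input q a) | a <- enum 'I_2]
  ++ [seq num (on_output q x) | x <- enum 'I_k].

(** Row 0 has no entries for output letters, which thus lead back to 0 by default; a challenge as
    first letter is accepted at once. *)
Definition rows : seq (seq nat) :=
  [:: num (To F0); 1] :: nseq (2 + k) 1 :: [seq row (dec e) | e <- enum ecode].

Lemma size_rows : size rows = #|ecode|.+2.
Proof. by rewrite /= size_map -cardE. Qed.

(** * Runs of the specification automaton *)

Variable W : seq nat.

Let A : dfa := game_dfa rows W.
Let dl := dfa_delta A.

Definition din (q : nat) (a : 'I_2) : nat := dl q (val a).
Definition dout (q : nat) (x : 'I_k) : nat := dl q (2 + val x).

Lemma nth_row_in q a : nth 0 (row q) (val a) = num (on_input q a).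
Proof.
rewrite nth_cat size_map size_enum_ord ltn_ord (nth_map tick);
  last by rewrite size_enum_ord ltn_ord.
by rewrite nth_ord_enum.
Qed.

Lemma nth_row_out q x : nth 0 (row q) (2 + val x) = num (on_output q x).
Proof.
rewrite nth_cat size_map size_enum_ord ltnNge leq_addr /= addKn.
by rewrite (nth_map x) ?size_enum_ord ?ltn_ord // nth_ord_enum.
Qed.

Lemma dlE q c : dl (num (To q)) c = nth 0 (row q) c.
Proof.
rewrite /dl /dfa_delta /A /= nth_cat size_map -cardE ltn_ord.
rewrite (nth_map (enc q)) -?cardE ?ltn_ord //.
by rewrite nth_enum_rank encK.
Qed.

Lemma din_To q a : din (num (To q)) a = num (on_input q a).
Proof. by rewrite /din dlE nth_row_in. Qed.

Lemma dout_To q x : dout (num (To q)) x = num (on_output q x).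
Proof. by rewrite /dout dlE nth_row_out. Qed.

Lemma din_0 a : din 0 a = if a == tick then num (To F0) else 1.
Proof. by case: (tick_or_chal a) => ->. Qed.

Lemma dout_0 x : dout 0 x = 0.
Proof. by rewrite /dout /dl /dfa_delta /= nth_nil. Qed.

Lemma din_1 a : din 1 a = 1.
Proof.
by case: (tick_or_chal a) => ->.
Qed.

Lemma dout_1 x : dout 1 x = 1.
Proof.
by rewrite /dout /dl /dfa_delta /= nth_nseq ltn_ord.
Qed.

Definition cs (i : nat) : nat := #|ecode|.+2 + i.

Lemma nth_chain V q i : nth [::] (chain V q) i =
  if i < size V then [:: 1, 1 & ncons (nth 0 V i) 0 [:: (q + i).+1]]
  else if i == size V then [:: 1; 1; 1; q + i] else [::].
Proof.
elim: V q i => [|x V IH] q [|i] //=; rewrite ?addn0 ?nth_nil //.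
by rewrite IH ltnS eqSS addSnnS.
Qed.

Lemma dl_chain i c : dl (cs i) c = nth 0 (nth [::] (chain W #|ecode|.+2) i) c.
Proof.
have E : A.1 = rows ++ chain W #|ecode|.+2 by rewrite -size_rows.
rewrite /dl /dfa_delta E nth_cat size_rows.
by rewrite ltnNge leq_addr /= addKn.
Qed.

Lemma din_chain i a : i <= size W -> din (cs i) a = 1.
Proof.
rewrite /din dl_chain nth_chain leq_eqVlt.
by case: eqP => [->|_]; rewrite ?ltnn ?eqxx; [|move=> /= ->];
  case: (tick_or_chal a) => ->.
Qed.

Lemma dout_chain i x : i < size W ->
  dout (cs i) x = if val x == nth 0 W i then cs i.+1 else 0.
Proof.
move=> lt_i; rewrite /dout dl_chain nth_chain lt_i /= nth_ncons.
case: ltngtP => [//|lt_x|->]; last by rewrite subnn /= /cs addnS.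
by rewrite -(subnSK lt_x) /= nth_nil.
Qed.

Lemma dout_loop x : dout (cs (size W)) x =
  if x == mark then 1 else if x == blank then cs (size W) else 0.
Proof.
rewrite /dout dl_chain nth_chain ltnn eqxx -!val_eqE mark0 blank1 /=.
by case: (val x) => [|[|n]] //=; rewrite nth_nil.
Qed.

Definition outs (q : nat) (v : seq 'I_k) : nat := foldl dout q v.
Definition ticks (q : nat) (v : seq 'I_k) : nat :=
  foldl (fun q x => dout (din q tick) x) q v.
Definition run (q : nat) (u : seq 'I_2) (v : seq 'I_k) : nat :=
  foldl dl q (map (@code 2 k) (mix u v)).

Lemma accepts_run u v :
  dfa_accepts A (map (@code 2 k) (mix u v)) = (run 0 u v == 1).
Proof. by rewrite /dfa_accepts inE. Qed.

Lemma run_nil q v : run q [::] v = outs q v.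
Proof.
rewrite /run /outs; have -> : mix [::] v = map inr v :> seq ('I_2 + 'I_k).
  by case: v.
by elim: v q => //= x v IH q; rewrite IH.
Qed.

Lemma run_cons q a u x v : run q (a :: u) (x :: v) = run (dout (din q a) x) u v.
Proof. by []. Qed.

Lemma run_ticks q u v w : run q (nseq (size v) tick ++ u) (v ++ w)
  = run (ticks q v) u w.
Proof. by elim: v q => //= x v IH q; rewrite run_cons IH. Qed.

Lemma run_acc u v : run 1 u v = 1.
Proof.
rewrite /run; elim: (mix u v) => //= -[a|x] w IH.
  by rewrite -/(din 1 a) din_1.
by rewrite -/(dout 1 x) dout_1.
Qed.

Lemma outs_0 v : outs 0 v = 0.
Proof. by elim: v => //= x v IH; rewrite dout_0. Qed.

Lemma outs_1 v : outs 1 v = 1.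
Proof. by elim: v => //= x v IH; rewrite dout_1. Qed.

Lemma outs_cons q x v : outs q (x :: v) = outs (dout q x) v.
Proof. by []. Qed.

Lemma outs_search c b v y : all (fun x => x != mark) (rcons v y) ->
  outs (num (To (Search c b))) (rcons v y) = num (To (Search c (y == c))).
Proof.
elim: v b => [|x v IH] b; rewrite [rcons _ _]/= [all _ _]/= => /andP[Hx Hv];
  rewrite outs_cons dout_To [on_output _ _]/= (negbTE Hx) //.
exact: IH.
Qed.

Lemma chain_size i v : i <= size W -> outs (cs i) v = 1 -> size W - i < size v.
Proof.
elim: v i => [|x v IH] i le_i; first by rewrite /= /cs.
move: le_i; rewrite leq_eqVlt => /orP[/eqP -> _|lt_i]; first by rewrite subnn.
rewrite outs_cons dout_chain //; case: eqP => _; last by rewrite outs_0.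
by move=> /(IH i.+1 lt_i) /=; rewrite -(subnSK lt_i).
Qed.

(** The default in [nth 1 W] is the code of the blank, on which the last chain state loops; so a
    single test covers the word and the padding behind it. *)
Lemma chain_outs i v : i <= size W -> all (fun x => x != mark) v ->
  outs (cs i) v =
  if [forall j : 'I_(size v), val (nth blank v j) == nth 1 W (i + j)]
  then cs (minn (size W) (i + size v)) else 0.
Proof.
elim: v i => [|x v IH] i le_i.
  move=> _; rewrite addn0 (minn_idPr le_i).
  by case: ifP => // /negP[]; apply/forallP => -[].
rewrite [all _ _]/= => /andP[xm vm]; rewrite outs_cons [size _]/=.
have E : [forall j : 'I_(size v).+1,
      val (nth blank (x :: v) j) == nth 1 W (i + j)] =
    (val x == nth 1 W i) &&
    [forall j : 'I_(size v), val (nth blank v j) == nth 1 W (i.+1 + j)].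
  apply/idP/andP => [/forallP H|[Hx /forallP H]]; last apply/forallP => j.
    split; first by have := H ord0; rewrite addn0.
    by apply/forallP => j; have := H (lift ord0 j); rewrite /= addSnnS.
  case: (unliftP ord0 j) => [j' ->|->]; last by rewrite addn0.
  by rewrite /= -addSnnS; apply: H.
move: le_i; rewrite leq_eqVlt => /orP[/eqP Ei|lt_i].
  rewrite E {1}Ei dout_loop (negbTE xm).
  rewrite [nth 1 W i]nth_default ?Ei //.
  have -> : (val x == 1) = (x == blank) by rewrite -blank1 val_eqE.
  case: eqP => _ /=; last by rewrite outs_0.
  rewrite IH // -Ei; congr (if _ then cs _ else _); last by lia.
  apply: eq_forallb => j; rewrite !(@nth_default _ 1 W) //; lia.
rewrite E dout_chain // (set_nth_default 1) //.
case: eqP => _ /=; last by rewrite outs_0.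
by rewrite IH // addSnnS.
Qed.

Lemma ticks_rcons q v x : ticks q (rcons v x) = dout (din (ticks q v) tick) x.
Proof. by rewrite /ticks foldl_rcons. Qed.

Lemma outs_rcons q v x : outs q (rcons v x) = dout (outs q v) x.
Proof. by rewrite /outs foldl_rcons. Qed.

Lemma outs_cat q v v' : outs q (v ++ v') = outs (outs q v) v'.
Proof. exact: foldl_cat. Qed.

Lemma mkseq_add (X : Type) (f : nat -> X) m n :
  mkseq f (m + n) = mkseq f m ++ [seq f i | i <- iota m n].
Proof. by rewrite /mkseq iotaD map_cat. Qed.

Lemma map_iota_rcons (X : Type) (f : nat -> X) m n :
  [seq f i | i <- iota m n.+1] = rcons [seq f i | i <- iota m n] (f (m + n)).
Proof. by rewrite -addn1 iotaD map_cat cats1. Qed.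

Lemma run_split_ticks n m u (v : nat -> 'I_k) w :
  run 0 (nseq n tick ++ u) (mkseq v (n + m) ++ w) =
  run (ticks 0 (mkseq v n)) u ([seq v i | i <- iota n m] ++ w).
Proof. by rewrite mkseq_add -catA -{1}(size_mkseq v n) run_ticks. Qed.

Section Run.

Variable w0 : seq 'I_k.
Hypothesis w0_gt0 : 0 < size w0.
Let Q := qrun step lam blank s0 w0.
Let z := qletter step lam blank s0 w0.

Lemma ticks_first (v : nat -> 'I_k) : v 0 != mark ->
  ticks 0 (mkseq v 1) = num (To F1).
Proof.
by move=> v0; rewrite /ticks /= din_0 eqxx dout_To /on_output (negbTE v0).
Qed.

Lemma ticks_qrun (v : nat -> 'I_k) t : v 0 != mark -> v 1 != mark ->
  (forall i, i < t -> v i.+2 = z i /\ v i.+2 != mark) ->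
  (Q t).1 <> Lose ->
  ticks 0 (mkseq v t.+2) = num (if (Q t).1 is Go s then To (Wait s) else Acc).
Proof.
move=> v0 v1; elim: t => [|t IH] Hv HQ.
  rewrite mkseqS ticks_rcons ticks_first // din_To dout_To.
  by rewrite /on_output (negbTE v1).
rewrite mkseqS ticks_rcons; have [vt vt_nm] := Hv t (leqnn _).
move: HQ IH; rewrite /Q.
case Et: (qrun step lam blank s0 w0 t).1 => [||s].
- move=> _ -> //; last by move=> i lt_i; apply: Hv; apply: ltnW.
  by rewrite din_1 dout_1 (qrun_Win (leqnSn t) Et).
- by move=> HQ; case: HQ; move: Et => /=; case: (qrun _ _ _ _ _ t) => [o w] /= ->.
- rewrite (qrun_step Et) => HQ -> //; last by move=> i lt_i; apply: Hv; apply: ltnW.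
  rewrite din_To dout_To /= (negbTE vt_nm) vt /z.
  by move: HQ; case: (step _ _).
Qed.

End Run.

(** * From output streams to queue runs without loss *)

Hypothesis lam_nonmark : forall s x, x != mark -> lam s x != mark.

(** The challenge after one tick forces the initial queue into the stream, challenges after more
    ticks force every further letter to be the one that the queue automaton wrote, and the runs of
    ticks exclude a loss. *)
Lemma game_sound (N : nat) (v : nat -> 'I_k) w0 : W = 1 :: map val w0 -> 2 < N ->
  (forall n, exists g, run 0 (nseq n.+1 tick) (mkseq v (N + n) ++ g) = 1) ->
  (forall n, exists x, run 0 (rcons (nseq n.+1 tick) chal)
                           (rcons (mkseq v (N + n)) x) = 1) ->
  exists p, forall t, (qrun step lam blank s0 (w0 ++ nseq p blank) t).1 <> Lose.
Proof.
(* Two of the [N] letters written first precede the queue; the others give its length [P]. *)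
move=> EW lt2N Htick Hchal; pose P := N - 2.
(* A later tick could leave the dead state 0 again, but each run of ticks is itself an input, after
   which only output letters follow. *)
have T n : ticks 0 (mkseq v n.+1) != 0.
  have [g] := Htick n; have -> : N + n = n.+1 + N.-1 by lia.
  rewrite -[nseq _ _]cats0 run_split_ticks run_nil.
  by case: eqP => // ->; rewrite outs_0.
have Ch n : exists x, outs (dout (din (ticks 0 (mkseq v n.+1)) chal) (v n.+1))
    (rcons [seq v i | i <- iota n.+2 P] x) = 1.
  have [x Hx] := Hchal n; exists x; rewrite -Hx.
  have -> : N + n = n.+1 + P.+1 by rewrite /P; lia.
  rewrite -[rcons (nseq _ _) _]cats1 -[rcons (mkseq _ _) _]cats1 run_split_ticks.
  by rewrite run_cons run_nil -cats1.
have v0 : v 0 != mark.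
  by apply: contra (T 0) => /eqP v0; rewrite /ticks /= din_0 dout_To /= v0 eqxx.
have v1 : v 1 != mark.
  apply: contra (T 1) => /eqP v1.
  by rewrite mkseqS ticks_rcons ticks_first // din_To dout_To /= v1 eqxx.
have [x0 Hx0] : exists x, outs (cs 0) (rcons [seq v i | i <- iota 1 P.+1] x) = 1.
  have [x] := Ch 0; rewrite ticks_first // din_To => Hx; exists x.
  by have -> : cs 0 = num ToChain by rewrite /cs addn0.
have le_wP : size w0 <= P.
  have := chain_size (leq0n _) Hx0.
  rewrite EW /= size_map size_rcons size_map size_iota.
  by lia.
set p := P - size w0; exists p; set w := w0 ++ nseq p blank.
have size_w : size w = P by rewrite size_cat size_nseq /p; lia.
have w_gt0 : 0 < size w by rewrite size_w /P; lia.
pose z := qletter step lam blank s0 w.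
(* Strong induction: the state reached at a challenge is known only if all earlier letters are
   right. *)
have C i s : (qrun step lam blank s0 w i).1 = Go s ->
    v i.+2 = z i /\ v i.+2 != mark.
  elim/ltn_ind: i s => i IH s Hi.
  have IH' j : j < i -> v j.+2 = z j /\ v j.+2 != mark.
    by move=> lt_ji; have [s' Hs'] := qrun_Go_prev (ltnW lt_ji) Hi; apply: IH Hs'.
  have wait j s' : j <= i -> (qrun step lam blank s0 w j).1 = Go s' ->
      ticks 0 (mkseq v j.+2) = num (To (Wait s')).
    move=> le_ji Hj; rewrite (@ticks_qrun w) //; rewrite ?Hj //.
    by move=> j' lt_j'; apply: IH'; apply: leq_trans le_ji.
  have vi : v i.+2 != mark.
    apply: contra (T i.+2) => /eqP vi.
    by rewrite mkseqS ticks_rcons (wait i s) // din_To dout_To /= vi eqxx.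
  split=> //.
  have nm j : j <= i.+2 -> v j != mark.
    case: j => [|[|j]] //; rewrite !ltnS leq_eqVlt => /orP[/eqP -> //|lt_j].
    by have [] := IH' j lt_j.
  (* The first [P] letters are prescribed by the chain. *)
  have [lt_iP|le_Pi] := ltnP i P.
    have E : rcons [seq v i | i <- iota 1 P.+1] x0 =
        [seq v i | i <- iota 1 i.+2]
        ++ rcons [seq v i | i <- iota i.+3 (P - i.+1)] x0.
      rewrite -rcons_cat -map_cat -iotaD.
      by congr (rcons [seq v i | i <- iota _ _] _); lia.
    move: Hx0; rewrite E outs_cat chain_outs //; last first.
      apply/allP => x /mapP[j]; rewrite mem_iota => lt_j ->; apply: nm; lia.
    case: ifP => [/forallP H _|_]; last by rewrite outs_0.
    have lt_i : i.+1 < size [seq v i | i <- iota 1 i.+2].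
      by rewrite size_map size_iota.
    have := H (Ordinal lt_i); rewrite (nth_map 0) ?size_iota // nth_iota //.
    rewrite /= add0n add1n EW /= => /eqP vE; apply: val_inj; rewrite /= vE.
    rewrite /z qletter_init ?size_w // nth_cat; case: ltnP => [lt_iw|le_wi].
      by rewrite (nth_map blank).
    by rewrite nth_nseq nth_default ?size_map //; case: ifP; rewrite blank1.
  (* This letter stands right before the mark when the challenge comes after [j + 2] ticks; it must
     be what is written on reading letter [j]. *)
  pose j := i - P; have le_ji : j <= i by rewrite leq_subr.
  have [s' Hj] := qrun_Go_prev le_ji Hi.
  have lt_ji : j < i by rewrite /j /P; lia.
  have [vj vj_nm] := IH' j lt_ji.
  have [x] := Ch j.+1; rewrite (wait j s') // din_To dout_To /=.
  have -> : P = P.-1.+1 by rewrite /P; lia.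
  rewrite map_iota_rcons; have -> : j.+3 + P.-1 = i.+2 by rewrite /j /P; lia.
  rewrite outs_rcons outs_search; last first.
    rewrite all_rcons vi; apply/allP => y /mapP[l]; rewrite mem_iota => lt_l ->.
    by apply: nm; move: lt_l; rewrite /j /P; lia.
  rewrite dout_To /=; case: (x == mark) => //; case: eqP => // -> _.
  have -> : i = size w + j by rewrite size_w /j; lia.
  by rewrite /z (qletter_lam _ Hj) // vj.
elim=> [//|t IH] HL.
case Et: (qrun step lam blank s0 w t).1 => [||s] //.
  by move: HL; rewrite (qrun_Win (leqnSn t) Et).
have [vt vt_nm] := C t s Et; have := T t.+2.
rewrite mkseqS ticks_rcons (@ticks_qrun w) ?Et //; last first.
  by move=> i lt_i; have [s' Hs'] := qrun_Go_prev (ltnW lt_i) Et; apply: C Hs'.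
rewrite din_To dout_To /= (negbTE vt_nm) vt.
by move: HL; rewrite (qrun_step Et) /z => ->.
Qed.

(** * A transducer from a winning queue run *)

Section Strategy.

Variables (w : seq 'I_k) (h : nat).
Hypotheses (w_gt0 : 0 < size w) (w_nonmark : all (fun x => x != mark) w).
Hypothesis EW : exists p w0, W = 1 :: map val w0 /\ w = w0 ++ nseq p blank.
Hypothesis win_h : (qrun step lam blank s0 w h).1 = Win.

Let z := qletter step lam blank s0 w.
Let N := (size w).+2.

(** Two blanks precede the queue; the second one is also the first letter that the chain demands. *)
Definition stream (i : nat) : 'I_k := if i is j.+2 then z j else blank.

(* States count the ticks read, up to the time when the queue automaton has won;
   the last state is reached earlier by a challenge. *)
Definition emit (c : nat) (a : 'I_2) : seq 'I_k :=
  if c == 0 then mkseq stream N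
  else if (a == tick) && (c < h.+3) then [:: stream (N + c.-1)]
  else if c < h.+3 then [:: mark] else [:: blank].

Definition next (c : nat) (a : 'I_2) : nat :=
  if (a == tick) && (c < h.+3) then c.+1 else h.+3.

Arguments emit : simpl never.
Arguments next : simpl never.

(** The initial state is not final, since no output is related to the empty input. *)
Definition strategy : sst 'I_2 'I_k :=
  @SST _ _ 'I_h.+4 ord0 (fun q a => Some (emit q a, inord (next q a)))
    (fun q => if q == ord0 then None else Some [::]).

Fixpoint trace (c : nat) (u : seq 'I_2) : seq ('I_2 + 'I_k) :=
  if u is a :: u' then inl a :: map inr (emit c a) ++ trace (next c a) u'
  else [::].

Fixpoint emits (c : nat) (u : seq 'I_2) : seq 'I_k :=
  if u is a :: u' then emit c a ++ emits (next c a) u' else [::].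

Lemma next_bounds c a : 0 < next c a < h.+4.
Proof. by rewrite /next; case: ifP => [/andP[_ H]|_] /=; rewrite ?ltnS. Qed.

Lemma val_next (c : nat) a : val (inord (next c a) : 'I_h.+4) = next c a.
Proof. by rewrite /= inordK //; have /andP[] := next_bounds c a. Qed.

Lemma trunE (q : 'I_h.+4) u : trun (T := strategy) q u =
  Some (trace q u, inord (foldl next q u)).
Proof.
elim: u q => [|a u IH] q /=; first by rewrite inord_val.
by rewrite IH val_next.
Qed.

Lemma sync_strategy u : sync strategy u =
  if u is [::] then None else Some (trace 0 u).
Proof.
rewrite /sync trunE /=; case: u => [|a u] //=.
  by rewrite (_ : inord 0 = ord0) ?eqxx //; apply: val_inj; rewrite /= inordK.
case: eqP => [E|_] /=; last by rewrite cats0.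
have : 0 < foldl next (next 0 a) u < h.+4.
  elim: u (next 0 a) {E} (next_bounds 0 a) => //= b u IH c _.
  by apply: IH; apply: next_bounds.
by move/andP=> [gt0 lt4]; move: gt0; rewrite -(inordK lt4) E.
Qed.

Lemma out_strategy a u : out strategy (a :: u) = Some (emits 0 (a :: u)).
Proof.
rewrite /out sync_strategy; congr Some.
have H c v : pi_o (trace c v) = emits c v; last exact: H.
elim: v c => //= b v IH c.
by rewrite -IH /pi_o pmap_cat -/(pi_o _) pi_o_inr.
Qed.

Lemma strategy_controlled : controlled ctrl strategy.
Proof.
move=> s [u]; rewrite sync_strategy; case: u => // a u E.
have {E s}-> : s = inl a :: map inr (mkseq stream N) ++ trace (next 0 a) u.
  by case: E.
apply/andP; split.
  by move: (_ :: _) => s'; elim: s' => //= -[].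
rewrite /dfa_accepts -/(cstate 0 _) cstate_start cstate_cat cstate_first.
have -> : size (mkseq stream N) < 3 = false.
  by rewrite size_mkseq ltnNge !ltnS w_gt0.
have H c q v : 0 < c -> q \in [:: 4; 6] -> cstate q (trace c v) \in [:: 4; 6].
  elim: v c q => //= b v IH c q c_gt0 Hq.
  rewrite cstate_turn // cstate_cat cstate_later.
  have -> : size (emit c b) = 1.
    by rewrite /emit eqn0Ngt c_gt0 /=; case: ifP => // _; case: ifP.
  by apply: IH => //; have /andP[] := next_bounds c b.
by apply: H => //; have /andP[] := next_bounds 0 a.
Qed.

Lemma emits_ticks c n u : 0 < c -> c + n <= h.+3 ->
  emits c (nseq n tick ++ u) =
  [seq stream i | i <- iota (N + c.-1) n] ++ emits (c + n) u.
Proof.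
elim: n c => [|n IH] c c_gt0 le_cn /=; first by rewrite addn0.
have lt_c : c < h.+3 by lia.
rewrite /emit /next eqxx lt_c eqn0Ngt c_gt0 /= IH //; last by lia.
by rewrite -addnS prednK // addSnnS.
Qed.

Lemma emits0_ticks n u : n < h.+3 ->
  emits 0 (nseq n.+1 tick ++ u) = mkseq stream (N + n) ++ emits n.+1 u.
Proof.
by move=> lt_n; rewrite mkseq_add /= emits_ticks // addn0 catA.
Qed.

Lemma split_ticks m (u : seq 'I_2) :
  (exists u', u = nseq m tick ++ u') \/
  (exists2 n, n < m & u = nseq n tick \/ exists u', u = nseq n tick ++ chal :: u').
Proof.
elim: m u => [|m IH] u; first by left; exists u.
case: u => [|a u]; first by right; exists 0 => //; left.
case: (tick_or_chal a) => ->; last by right; exists 0 => //; right; exists u.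
case: (IH u) => [[u' ->]|[n lt_n H]]; first by left; exists u'.
right; exists n.+1 => //.
by case: H => [->|[u' ->]]; [left | right; exists u'].
Qed.

Lemma blank_nonmark : blank != mark.
Proof. by rewrite -val_eqE mark0 blank1. Qed.

Lemma stream_nonmark i : stream i != mark.
Proof.
case: i => [|[|i]]; rewrite ?blank_nonmark //=.
exact: (@qletterP _ _ step lam blank s0 w (fun x => x != mark)
  blank_nonmark w_nonmark lam_nonmark).
Qed.

Lemma ticks_stream t : (qrun step lam blank s0 w t).1 <> Lose ->
  ticks 0 (mkseq stream t.+2) =
  num (if (qrun step lam blank s0 w t).1 is Go s then To (Wait s) else Acc).
Proof.
by apply: ticks_qrun; rewrite ?stream_nonmark // => i _; rewrite stream_nonmark.
Qed.

Lemma qrun_notLose t : t <= h -> (qrun step lam blank s0 w t).1 <> Lose.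
Proof. by move=> le_th /(qrun_Lose le_th); rewrite win_h. Qed.

Lemma run_input q u a v x : q = 1 \/ (exists i, i <= size W /\ q = cs i) \/
    (exists c b, q = num (To (Search c b))) ->
  run q (a :: u) (x :: v) = 1.
Proof.
rewrite run_cons => -[->|[[i [le_i ->]]|[c [b ->]]]].
- by rewrite din_1 dout_1 run_acc.
- by rewrite din_chain // dout_1 run_acc.
- by rewrite din_To dout_1 run_acc.
Qed.

Lemma num_Acc : num Acc = 1.
Proof. by []. Qed.

(** After [h.+2] ticks the queue automaton has won. Fewer ticks are followed by the end of the input
    or by a challenge, which matters only if it is last. The mark then comes right behind the letter
    that the queue automaton writes, or, after a single tick, behind the initial queue. *)
Lemma run_strategy a u : run 0 (a :: u) (emits 0 (a :: u)) = 1.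
Proof.
have [p [w0 [W_eq w_eq]]] := EW.
case: (split_ticks h.+2 (a :: u)) => [[u' ->]|[n lt_n Hu]].
  rewrite emits0_ticks //; have -> : N + h.+1 = h.+2 + N.-1 by rewrite /N; lia.
  rewrite run_split_ticks ticks_stream; last exact: qrun_notLose.
  by rewrite win_h num_Acc run_acc.
case: n lt_n Hu => [|n] lt_n Hu.
  by case: Hu => // -[u' [-> ->]]; rewrite /= run_cons din_0 /= dout_1 run_acc.
have lt_n3 : n < h.+3 by lia.
have N_eq : N + n = n.+1 + (size w).+1 by rewrite /N; lia.
have tn : (n = 0 /\ ticks 0 (mkseq stream n.+1) = num (To F1)) \/
    exists2 j, n = j.+1 & ticks 0 (mkseq stream n.+1) =
    num (if (qrun step lam blank s0 w j).1 is Go s then To (Wait s) else Acc).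
  case: n {Hu lt_n3 N_eq} lt_n => [|j] lt_j.
    by left; split=> //; rewrite ticks_first // stream_nonmark.
  by right; exists j; rewrite // ticks_stream //; apply: qrun_notLose; lia.
case: Hu => [|[u']] ->.
  rewrite -[nseq _ _]cats0 emits0_ticks // N_eq run_split_ticks cats0 run_nil.
  rewrite [iota _ _]/= [map _ (_ :: _)]/= outs_cons.
  case: tn => [[_ ->]|[j _ ->]]; first by rewrite dout_To num_Acc outs_1.
  by case: (qrun _ _ _ _ _ j).1 => [||s];
    rewrite ?num_Acc ?dout_1 ?dout_To ?num_Acc outs_1.
rewrite emits0_ticks // N_eq run_split_ticks.
have -> : emits n.+1 (chal :: u') = mark :: emits h.+3 u'.
  by rewrite /= /emit /next /= ltnW.
rewrite [iota _ _]/= [map _ (_ :: _)]/= cat_cons run_cons.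
set q := dout _ _; have Hq : q = 1 \/ (n = 0 /\ q = cs 1) \/
    (exists j s, [/\ n = j.+1, (qrun step lam blank s0 w j).1 = Go s
                 & q = num (To (Search (lam s (z j)) false))]).
  rewrite /q; case: tn => [[n0 ->]|[j nj ->]].
    rewrite din_To; right; left; split=> //.
    have -> : num (on_input F1 chal) = cs 0 by rewrite /cs addn0.
    rewrite n0 dout_chain; last by rewrite W_eq.
    by rewrite W_eq /= blank1.
  case Ej: (qrun step lam blank s0 w j).1 => [||s].
  - by left; rewrite num_Acc din_1 dout_1.
  - by left; rewrite num_Acc din_1 dout_1.
  - by right; right; exists j, s; rewrite din_To dout_To nj.
have [m size_w] : exists m, size w = m.+1 by exists (size w).-1; rewrite prednK.
case: u' => [|b u'].
  rewrite run_nil cats1 outs_rcons; case: Hq => [->|[[n0 ->]|[j [s [nj Hj ->]]]]].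
  - by rewrite outs_1 dout_1.
  - rewrite n0 chain_outs; first last.
    + by apply/allP => x /mapP[l _ ->]; apply: stream_nonmark.
    + by rewrite W_eq.
    rewrite ifT; last first.
      apply/forallP => l; have lt_l : l < size w.
        by apply: leq_trans (ltn_ord l) _; rewrite size_map size_iota.
      move: (nat_of_ord l) lt_l => {}l lt_l.
      rewrite (nth_map 0) ?size_iota // nth_iota //= /z qletter_init // add0n.
      rewrite W_eq w_eq nth_cat /=; case: ltnP => [lt_l0|le_l0].
        by rewrite (nth_map blank).
      by rewrite nth_nseq (nth_default 1) ?size_map //; case: ifP; rewrite blank1.
    rewrite size_map size_iota (minn_idPl _) ?dout_loop ?eqxx //.
    by rewrite W_eq w_eq /= size_map size_cat; lia.
  - rewrite size_w map_iota_rcons.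
    have -> : n.+2 + m = (size w + j).+2 by lia.
    rewrite outs_search; last first.
      rewrite all_rcons stream_nonmark; apply/allP => x /mapP[l _ ->].
      exact: stream_nonmark.
    rewrite dout_To /= eqxx.
    by rewrite /= /z (qletter_lam w_gt0 Hj) eqxx.
rewrite size_w [iota _ _]/= [map _ (_ :: _)]/= cat_cons; apply: run_input.
case: Hq => [->|[[_ ->]|[j [s [_ _ ->]]]]]; [by left | right; left | right; right].
  by exists 1; rewrite W_eq.
by exists (lam s (z j)), false.
Qed.

Lemma run_empty v : run 0 [::] v = 0.
Proof. by rewrite run_nil outs_0. Qed.

Lemma strategy_uniformizes : uniformizes strategy (@autrel 2 k A).
Proof.
have R u v : autrel A u v <-> run 0 u v = 1.
  by rewrite autrelP accepts_run; split=> /eqP.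
split=> [u|u v].
  case: u => [|a u]; rewrite sync_strategy; split=> //.
  - by case=> v /R; rewrite run_empty.
  - by move=> _; exists (emits 0 (a :: u)); apply/R; apply: run_strategy.
case: u => [|a u]; first by rewrite /out sync_strategy.
by rewrite out_strategy => -[<-]; apply/R; apply: run_strategy.
Qed.

End Strategy.

(** * The domain of the relation, and both implications *)

Hypothesis step_blank : forall s, step s blank <> Lose.
Variable w0 : seq 'I_k.
Hypotheses (W_eq : W = 1 :: map val w0) (w0_nonmark : all (fun x => x != mark) w0).

Lemma ticks_blank n : (n = 0 /\ ticks 0 (nseq n.+1 blank) = num (To F1)) \/
  ticks 0 (nseq n.+1 blank) = 1 \/
  exists s, ticks 0 (nseq n.+1 blank) = num (To (Wait s)).
Proof.
have nseq_rcons m : nseq m.+1 blank = rcons (nseq m blank) blank.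
  by rewrite -cats1 -[[:: blank]]/(nseq 1 blank) -nseqD addn1.
have bm := negbTE blank_nonmark.
elim: n => [|n IH].
  by left; rewrite nseq_rcons ticks_rcons /= din_0 dout_To /on_output bm.
rewrite nseq_rcons ticks_rcons; right.
case: IH => [[_ ->]|[->|[s ->]]].
- by right; exists s0; rewrite din_To dout_To /on_output bm.
- by left; rewrite din_1 dout_1.
- rewrite din_To dout_To /= bm; have := step_blank (s := s).
  by case: (step s blank) => [||s'] // _; [left | right; exists s'].
Qed.

Lemma dom_ticks n : exists v, run 0 (nseq n.+1 tick) v = 1.
Proof.
(* The additional blank takes [F1] and [Wait] to acceptance. *)
exists (nseq n.+1 blank ++ [:: blank]).
rewrite -[nseq n.+1 tick]cats0 -{1}(size_nseq n.+1 blank) run_ticks.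
rewrite run_nil outs_cons.
by case: (ticks_blank n) => [[_ ->]|[->|[s ->]]]; rewrite ?dout_1 ?dout_To.
Qed.

Lemma dom_chal n : exists v, run 0 (rcons (nseq n.+1 tick) chal) v = 1.
Proof.
suff [v Hv] : exists v, run (ticks 0 (nseq n.+1 blank)) [:: chal] v = 1.
  exists (nseq n.+1 blank ++ v).
  by rewrite -cats1 -{1}(size_nseq n.+1 blank) run_ticks.
case: (ticks_blank n) => [[_ ->]|[->|[s ->]]].
- exists (rcons (blank :: w0) mark).
  have -> : rcons (blank :: w0) mark = blank :: rcons w0 mark by [].
  rewrite run_cons run_nil din_To -outs_cons -rcons_cons outs_rcons.
  have -> : num (on_input F1 chal) = cs 0 by rewrite /cs addn0.
  rewrite chain_outs //; last by rewrite /= blank_nonmark.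
  rewrite ifT; last first.
    apply/forallP => -[[|l] lt_l]; rewrite W_eq /= ?blank1 //.
    by rewrite (nth_map blank).
  have -> : minn (size W) (0 + size (blank :: w0)) = size W.
    by rewrite W_eq /= size_map minnn.
  by rewrite dout_loop eqxx.
- by exists [:: blank]; rewrite run_acc.
(* The domain imposes no delay, so the letter demanded can be written at once. *)
- exists [:: blank; lam s blank; mark].
  rewrite run_cons run_nil din_To dout_To /= dout_To /=.
  rewrite (negbTE (lam_nonmark s blank_nonmark)) eqxx dout_To /= eqxx.
  by [].
Qed.

Lemma game_soundness (T : sst 'I_2 'I_k) :
  controlled ctrl T -> uniformizes T (@autrel 2 k A) ->
  exists p, forall t, (qrun step lam blank s0 (w0 ++ nseq p blank) t).1 <> Lose.
Proof.
move=> T_ctrl [T_dom T_out].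
have R u v : autrel A u v <-> run 0 u v = 1.
  by rewrite autrelP accepts_run; split=> /eqP.
have [||N [v [lt2N Htick Hchal]]] := delay_stream T_ctrl.
- by move=> n; apply/T_dom; have [v Hv] := dom_ticks n; exists v; apply/R.
- by move=> n; apply/T_dom; have [v Hv] := dom_chal n; exists v; apply/R.
apply: (game_sound W_eq lt2N (v := v)) => n.
- by have [g Hg] := Htick n; exists g; apply/R/T_out.
- by have [x Hx] := Hchal n; exists x; apply/R/T_out.
Qed.

Lemma game_completeness p h : 0 < size w0 ->
  (qrun step lam blank s0 (w0 ++ nseq p blank) h).1 = Win ->
  exists T : sst 'I_2 'I_k, controlled ctrl T /\ uniformizes T (@autrel 2 k A).
Proof.
move=> w0_gt0 win_h; exists (strategy (w0 ++ nseq p blank) h).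
have w_gt0 : 0 < size (w0 ++ nseq p blank) by rewrite size_cat ltn_addr.
split; first exact: strategy_controlled.
apply: strategy_uniformizes => //; last by exists p, w0.
by rewrite all_cat w0_nonmark all_nseq blank_nonmark orbT.
Qed.

End Game.
(** * Undecidability *)

Lemma ins_bounded_leq K K' i : K <= K' -> ins_bounded K i -> ins_bounded K' i.
Proof.
move=> leK; case: i => [[[a r] t] t'] /= /andP[Ha Hr]; apply/andP; split.
  by case: a Ha => // a /leq_trans; apply.
by case: r Hr => // r /leq_trans; apply.
Qed.

(** The bound exceeds 3 so that the registers 0 to 3 of the parameters have tokens. *)
Lemma prog_bounded (P : seq ins) : exists2 K, 3 < K & all (ins_bounded K) P.
Proof.
elim: P => [|i P [K K3 HP]]; first by exists 4.
have [K' HK'] : exists K', ins_bounded K' i.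
  case: i => [[[a r] t] t'].
  exists (maxn (if a is Some q then q.+1 else 0) (if r is Some q then q.+1 else 0)).
  by case: a r => [a|] [r|]; rewrite /= ?leq_maxl ?leq_maxr ?leqnn.
exists (maxn K K'); first by rewrite (leq_trans K3) ?leq_maxl.
rewrite /= (ins_bounded_leq (leq_maxr _ _) HK').
by apply: sub_all HP => j; apply: ins_bounded_leq; apply: leq_maxl.
Qed.

(** * The instance attached to a program *)

Section Instance.

Variables (K : nat) (P : seq ins).
Hypotheses (K_gt3 : 3 < K) (P_bounded : all (ins_bounded K) P).

Definition prog_rows : seq (seq nat) :=
  rows (lt K 0) (qstep (P := P)) (qlam (P := P)) None.

(** Only the rows in front of the chain enter, so the word of the chain may depend on these numbers
    without circularity. *)
Definition prog_params : seq nat := params prog_rows K.+4.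

Definition prog_word : seq nat :=
  1 :: tokens (nth 0 prog_params 0) (nth 0 prog_params 1)
              (nth 0 prog_params 2) (nth 0 prog_params 3).

(** The additional 1 is the second letter of the stream; the 1 in [prog_word] is the queue letter
    for which the initial state writes the separator. *)
Definition prog_instance : instance :=
  (2, K.+4, game_dfa prog_rows (1 :: prog_word), ctrl).

Lemma val_lt n : n < K.+4 -> val (lt K n) = n.
Proof. by move=> Hn; rewrite /lt -lock /= inordK. Qed.

Lemma prog_word_bounds : all (fun x => 0 < x < K.+4) prog_word.
Proof.
have H n c : 0 < c < K.+4 -> all (fun x => 0 < x < K.+4) (nseq n c).
  by move=> Hc; rewrite all_nseq Hc orbT.
by rewrite [all _ _]/= !all_cat !H //; lia.
Qed.

Lemma unif_instance : unif_problem prog_instance <-> halts P (nth 0 prog_params).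
Proof.
have mark0 : val (lt K 0) = 0 by rewrite val_lt.
have blank1 : val (blank K) = 1 by rewrite val_lt.
have lamP : forall s x, x != lt K 0 -> qlam (P := P) s x != lt K 0.
  by move=> s x; apply: qlam_nonmark.
have W_eq : 1 :: prog_word = 1 :: map val (map (lt K) prog_word).
  rewrite -map_comp -[in LHS](map_id prog_word); congr (_ :: _).
  by apply/eq_in_map => x /(allP prog_word_bounds) /andP[_ /val_lt].
have nm : all (fun x => x != lt K 0) (map (lt K) prog_word).
  rewrite all_map; apply: sub_all prog_word_bounds => x /= /andP[x_gt0 lt_x].
  by rewrite lt_eq // -lt0n.
split=> [[T [T_ctrl T_unif]]|].
  have [p Hp] := game_soundness mark0 blank1 lamP (@qstep_blank K P) W_eq nm
    T_ctrl T_unif.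
  exact: (queue_never_loses_halts P_bounded (p := p) K_gt3).
move=> /(halts_queue_wins P_bounded K_gt3) [//|p [h win_h]].
exact: (game_completeness mark0 blank1 lamP W_eq nm (p := p) (h := h)).
Qed.

End Instance.

Theorem mainTheorem6 : ~ rec_decidable unif_problem.
Proof.
move=> [f Hf].
have [r Hr] := computable_inst_code (pickle ctrl).
(* From four parameters [e] computes the answer for the instance that has them, so [P] is fixed
   before its own instance is formed. *)
pose e := rComp f [:: r]; pose P := prog_of e 4.
have [K K_gt3 P_bounded] := prog_bounded P.
set v := prog_params K P; have v4 : size v = 4 by [].
have pickleE : pickle (prog_instance K P) = inst_code (pickle ctrl) v.
  exact: pickle_inst.
have [Hyes Hno] := Hf (prog_instance K P).
have unifP := unif_instance K_gt3 P_bounded.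
have evale y : eval f [:: pickle (prog_instance K P)] y -> eval e v y.
  rewrite pickleE => Hy; apply: evComp Hy.
  by apply: evsCons; [apply: Hr | apply: evsNil].
(* If the instance were solvable, the answer 1 would make [P] run forever, although solvability
   means that [P] halts. With solvability refuted, the answer 0 makes [P] halt, which gives
   solvability. *)
have nunif : ~ unif_problem (prog_instance K P).
  move=> H; have := prog_of_diverges (evale _ (Hyes H)).
  by rewrite v4; apply; apply/unifP.
apply: (nunif); apply/unifP.
by have := prog_of_halts (evale _ (Hno nunif)); rewrite v4.
Qed.
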